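(* For any rooted graph $(G,R)$, $$\mathcal{HT}\big(\mathcal{T}(G,R)\big)\cong U\big(L_{\mathbb{Z}}(G,R)\big)/DU\big(L_{\mathbb{Z}}(G,R)\big).$$
   Context: Graphs are directed with multiple edges and loops allowed: $G=(VG,EG,o,t)$ with origin and terminus maps $o,t:EG\to VG$. All graphs are locally finite: $|o^{-1}(v)|<\infty$ for every $v\in VG$. A path is either an empty path $\varepsilon_v$ ($v\in VG$) or a word $e_1\dots e_n$ ($n\ge 1$) of edges with $t(e_i)=o(e_{i+1})$. $\mathcal{W}(G)$ is the set of all paths; $O(e_1\dots e_n)=o(e_1)$, $T(e_1\dots e_n)=t(e_n)$, $O(\varepsilon_v)=T(\varepsilon_v)=v$; $\mathcal{W}(G,v)$ is the set of paths $p$ with $O(p)=v$. Paths $p,q$ with $T(p)=O(q)$ are concatenated to $pq$, empty paths being neutral. A rooted graph $(G,R)$ is a graph $G$ with a vertex $R$ (the root) from which every vertex can be reached by a directed path. The unfolding tree $\mathcal{T}(G,R)$ has vertex set $\mathcal{W}(G,R)$ and edges $(p,pe)$ from $p$ to $pe$. The prefix order is $p\preceq q\iff q=pr$ for some path $r$. A set of paths is independent if none of its elements is a prefix of another one. A finite maximal basis of $\mathcal{T}(G,R)$ is a finite independent subset of $\mathcal{W}(G,R)$ that is inclusion-maximal among independent subsets. A cofinite subspace of $\mathcal{T}(G,R)$ is a subset $\mathcal{S}\subseteq\mathcal{W}(G,R)$ with finite complement such that $p\in\mathcal{S}$, $p\preceq q$ imply $q\in\mathcal{S}$. Its basis is the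 unique finite independent subset $B\subseteq\mathcal{S}$ such that every $p\in\mathcal{S}$ has a prefix in $B$. An almost automorphism representative is an isomorphism $\phi:\mathcal{S}\to\mathcal{S}'$ between cofinite subspaces (a bijection preserving the prefix/forest structure in both directions). It is a Higman--Thompson representative if, for the basis $B$ of its domain, $\phi(bp)=\phi(b)p$ for all $b\in B$ and $p\in\mathcal{W}(G,T(b))$ (in particular $\phi(b)p$ is a path, so $T(\phi(b))=T(b)$). Two representatives are equivalent if they agree on some cofinite subspace. Equivalence classes of representatives form a group under composition of compatible (suitably restricted) representatives; $\mathcal{HT}(\mathcal{T}(G,R))$ is the subgroup of classes containing a Higman--Thompson representative. The Leavitt path algebra $L_{\mathbb{Z}}(G)$ is the (a priori non-unital) $\mathbb{Z}$-algebra generated by $VG\sqcup\{e,e^*\mid e\in EG\}$ with relations: $vw=\delta_{v,w}v$ for $v,w\in VG$; $e^*e'=0$ if $e\ne e'$ and $e^*e=t(e)$; $o(e)e=e\,t(e)=e$; $t(e)e^*=e^*o(e)=e^*$; and $v=\sum_{e\in o^{-1}(v)}ee^*$ whenever $o^{-1}(v)\neq\emptyset$. It has the linear involution $*$ with $(xy)^*=y^*x^*$, $v^*=v$, $(e)^*=e^*$, $(e^* )^*=e$. A path $p=e_1\dots e_n$ is viewed as the product of its edges, $p^*=e_n^*\dots e_1^*$, and $\varepsilon_v=v$. The rooted Leavitt path algebra $L_{\mathbb{Z}}(G,R)$ is the $\mathbb{Z}$-submodule of $L_{\mathbb{Z}}(G)$ generated by $\{pq^*\mid p,q\in\mathcal{W}(G,R),\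 T(p)=T(q)\}$; it is a $*$-subalgebra with unit $R$. Its unitary group is $U(L_{\mathbb{Z}}(G,R))=\{x\in L_{\mathbb{Z}}(G,R)\mid xx^*=x^*x=R\}$, and its subgroup of diagonal unitary elements is $$DU\big(L_{\mathbb{Z}}(G,R)\big)=\Big\{\sum_{b\in B}\kappa_b bb^*\ \Big|\ B\text{ a finite maximal basis of }\mathcal{T}(G,R),\ \kappa_b\in\{1,-1\}\Big\}.$$
   Formalization: Cofinite subspaces are additionally required to contain every path ending in a sink (void if G has no sinks); without this the claim fails, e.g. for two parallel edges from R to a sink, where HT is trivial but U/DU has order 2. *)

(* Defs.v *)
From HB Require Import structures.
From mathcomp Require Import all_boot all_order all_algebra finmap.
From mathcomp Require Import all_classical.

Set Implicit Arguments.
Unset Strict Implicit.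
Unset Printing Implicit Defensive.
Import GRing.Theory.
Local Open Scope classical_set_scope.
Local Open Scope quotient_scope.

(** * Quotient of a group by a normal subgroup *)

Definition normal_subgroup (gT : groupType) (N : {pred gT}) : Prop :=
  group_closed N /\ forall x y : gT, x \in N -> (x ^ y)%g \in N.

Section QuotientGroup.
Variables (gT : groupType) (N : {pred gT}).

Definition same_coset (x y : gT) : bool := (x^-1 * y)%g \in N.

Hypothesis nN : normal_subgroup N.

Let N1 : 1%g \in N. Proof. exact: nN.1.1. Qed.
Let NV x : x \in N -> x^-1%g \in N. Proof. exact: group_closedV nN.1 x. Qed.
Let NM x y : x \in N -> y \in N -> (x * y)%g \in N.
Proof. exact: group_closedM nN.1 x y. Qed.
Let NJ x y : x \in N -> (x ^ y)%g \in N. Proof. exact: nN.2. Qed.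

Lemma same_coset_refl : reflexive same_coset.
Proof. by move=> x; rewrite /same_coset mulVg. Qed.

Lemma same_coset_sym : symmetric same_coset.
Proof.
by move=> x y; apply/idP/idP => /NV; rewrite /same_coset invgM invgK.
Qed.

Lemma same_coset_trans : transitive same_coset.
Proof.
by move=> y x z xy /(NM xy); rewrite /same_coset mulgA mulgK.
Qed.

Definition same_coset_equiv :=
  EquivRel same_coset same_coset_refl same_coset_sym same_coset_trans.

Definition quotient_group : Type := {eq_quot same_coset_equiv}.
HB.instance Definition _ := Choice.on quotient_group.
HB.instance Definition _ := EqQuotient.on quotient_group.

Definition coset_class (x : gT) : quotient_group := \pi_(quotient_group) x.

Definition quotient_one : quotient_group := coset_class 1%g.
Definition quotient_inv (x : quotient_group) : quotient_group :=
  coset_class (repr x)^-1%g.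
Definition quotient_mul (x y : quotient_group) : quotient_group :=
  coset_class (repr x * repr y)%g.

Lemma coset_classP (x y : gT) :
  coset_class x = coset_class y <-> (x^-1 * y)%g \in N.
Proof. by split=> [/eqmodP//|h]; apply/eqmodP. Qed.

Lemma coset_classK (x : quotient_group) : coset_class (repr x) = x.
Proof. exact: reprK. Qed.

Let reprP (x : gT) : ((repr (coset_class x))^-1 * x)%g \in N.
Proof. by apply/coset_classP; rewrite coset_classK. Qed.

Lemma coset_classM (x y : gT) :
  quotient_mul (coset_class x) (coset_class y) = coset_class (x * y)%g.
Proof.
apply/coset_classP; set a := repr _; set b := repr _.
have -> : ((a * b)^-1 * (x * y) = (a^-1 * x) ^ b * (b^-1 * y))%g.
  by rewrite /conjg invgM !mulgA mulgK.
by apply: NM; [apply: NJ|]; apply: reprP.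
Qed.

Lemma coset_classV (x : gT) :
  quotient_inv (coset_class x) = coset_class (x^-1)%g.
Proof.
apply/coset_classP; set a := repr _.
have -> : (a^-1^-1 * x^-1 = ((a^-1 * x)^-1) ^ a^-1)%g.
  by rewrite /conjg invgM !invgK !mulgA mulgK.
by apply/NJ/NV/reprP.
Qed.

Fact quotient_mulA : associative quotient_mul.
Proof.
move=> x y z; rewrite -(coset_classK x) -(coset_classK y) -(coset_classK z) !coset_classM.
by rewrite mulgA.
Qed.
Fact quotient_mul1 : left_id quotient_one quotient_mul.
Proof. by move=> x; rewrite -(coset_classK x) coset_classM mul1g. Qed.
Fact quotient_1mul : right_id quotient_one quotient_mul.
Proof. by move=> x; rewrite -(coset_classK x) coset_classM mulg1. Qed.
Fact quotient_mulV : left_inverse quotient_one quotient_inv quotient_mul.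
Proof. by move=> x; rewrite -(coset_classK x) coset_classV coset_classM mulVg. Qed.
Fact quotient_Vmul : right_inverse quotient_one quotient_inv quotient_mul.
Proof. by move=> x; rewrite -(coset_classK x) coset_classV coset_classM mulgV. Qed.

HB.instance Definition _ := isGroup.Build quotient_group
  quotient_mulA quotient_mul1 quotient_1mul quotient_mulV quotient_Vmul.

End QuotientGroup.

(** * Graphs, paths and unfolding trees *)

Record graph := Graph {
  vertex : choiceType;
  edge : choiceType;
  org : edge -> vertex;
  ter : edge -> vertex;
  locally_finite : forall v, finite_set [set e | org e = v]
}.

Section Walks.
Variable G : graph.

Fixpoint is_walk (v : vertex G) (s : seq (edge G)) : bool :=
  if s is e :: s' then (org e == v) && is_walk (ter e) s' else true.

Definition word_end (v : vertex G) (s : seq (edge G)) : vertex G :=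
  last v (map (@ter G) s).

(* [walk v] is the set of paths with origin [v]; the empty word of [walk v] is
   the empty path at [v]. *)
Record walk (v : vertex G) := Walk {
  edges : seq (edge G);
  edgesP : is_walk v edges
}.

HB.instance Definition _ v := [isSub for @edges v].
HB.instance Definition _ v := [Choice of walk v by <:].

Lemma is_walk_cat v s1 s2 :
  is_walk v (s1 ++ s2) = is_walk v s1 && is_walk (word_end v s1) s2.
Proof. by elim: s1 v => //= e s1 IH v; rewrite IH andbA. Qed.

Lemma word_end_cat v s1 s2 :
  word_end v (s1 ++ s2) = word_end (word_end v s1) s2.
Proof. by rewrite /word_end map_cat last_cat. Qed.

Definition tgt v (p : walk v) : vertex G := word_end v (edges p).

Definition wnil v : walk v := @Walk v [::] isT.

Definition wcat v (p : walk v) (q : walk (tgt p)) : walk v :=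
  @Walk v (edges p ++ edges q)
    (etrans (is_walk_cat _ _ _) (introT andP (conj (edgesP p) (edgesP q)))).

Definition is_root (R : vertex G) : Prop :=
  forall v, exists p : walk R, tgt p = v.

Variable R : vertex G.
Implicit Types (p q : walk R) (S B : set (walk R)).

Definition wle p q : Prop := exists r : walk (tgt p), q = wcat r.

Definition independent B : Prop :=
  forall p q, B p -> B q -> wle p q -> p = q.

Definition finite_maximal_basis B : Prop :=
  [/\ finite_set B, independent B
    & forall C, independent C -> B `<=` C -> C = B].

Definition leaf p : Prop := forall q, wle p q -> q = p.

(* The unfolding tree has leaves as soon as the graph has sinks.  The last
   condition keeps them; by [cofinite_subspaceE] it is void in the absence of
   sinks.  Without it, germs modulo cofinite subspaces would forget every finite
   set of leaves: for two parallel edges from R to a sink, the empty set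
   would be a cofinite subspace and the Higman-Thompson group would be trivial,
   while the unitary group of the 2x2 integer matrices modulo diagonal ones has
   order 2. *)
Definition cofinite_subspace S : Prop :=
  [/\ finite_set (~` S),
      (forall p q, S p -> wle p q -> S q)
    & (forall p, leaf p -> S p)].

Lemma wleP p q : wle p q <-> exists s, edges q = edges p ++ s.
Proof.
split=> [[r ->]|[s qE]]; first by exists (edges r).
have := edgesP q; rewrite qE is_walk_cat => /andP[_ ws].
by exists (Walk ws); apply: val_inj.
Qed.

Lemma wle_refl p : wle p p.
Proof. by apply/wleP; exists [::]; rewrite cats0. Qed.

Lemma wle_trans p q r : wle p q -> wle q r -> wle p r.
Proof.
move=> /wleP[s qE] /wleP[t rE]; apply/wleP; exists (s ++ t).
by rewrite rE qE catA.
Qed.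

Lemma wle_size p q : wle p q -> q != p -> size (edges p) < size (edges q).
Proof.
move=> /wleP[[|e s] qE] neq; last by rewrite qE size_cat /= addnS leq_addr.
by case/eqP: neq; apply: val_inj; rewrite /= qE cats0.
Qed.

Lemma finite_extensions p :
  finite_set [set q : walk R | exists e, edges q = rcons (edges p) e].
Proof.
pose f := rcons (edges p).
have fin := finite_image f (locally_finite (tgt p)).
have inj : {in @edges R @^-1` (f @` [set e | org e = tgt p]) &,
  injective (@edges R)} by move=> a b _ _; apply: val_inj.
apply: sub_finite_set (finite_preimage inj fin).
move=> q /= [e qE]; exists e; last by rewrite qE.
by have := edgesP q; rewrite qE -cats1 is_walk_cat /= andbT => /andP[_ /eqP].
Qed.

Lemma cofinite_subspaceE S : (forall v, exists e : edge G, org e = v) ->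
  cofinite_subspace S <->
  finite_set (~` S) /\ (forall p q, S p -> wle p q -> S q).
Proof.
move=> nosink; split=> [[]//|[fS uS]]; split=> // p lp.
have [e eE] := nosink (tgt p).
have we : is_walk (tgt p) [:: e] by rewrite /= eE eqxx.
have /lp /(congr1 (fun q => size (edges q))) : wle p (wcat (Walk we)).
  by exists (Walk we).
by move/eqP; rewrite /= size_cat /= addn1 -[X in _ == X]addn0 -addn1 eqn_add2l.
Qed.

Lemma cofinite_subspaceT : cofinite_subspace [set: walk R].
Proof. by split=> //; rewrite setCT. Qed.

Lemma cofinite_subspaceI S S' : cofinite_subspace S -> cofinite_subspace S' ->
  cofinite_subspace (S `&` S').
Proof.
move=> [f1 u1 l1] [f2 u2 l2]; split; first by rewrite cofinite_setI.
- by move=> p q [p1 p2] pq; split; [apply: u1 pq|apply: u2 pq].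
- by move=> p lp; split; [apply: l1|apply: l2].
Qed.

Definition is_basis S B : Prop :=
  [/\ finite_set B, independent B, B `<=` S
    & forall p, S p -> exists2 b, B b & wle b p].

Lemma cofinite_subspace_basis S : cofinite_subspace S ->
  exists B, is_basis S B.
Proof.
move=> [fS uS lS]; exists [set p | S p /\ forall q, S q -> wle q p -> q = p].
split.
- have /sub_finite_set : [set p | S p /\ forall q, S q -> wle q p -> q = p]
    `<=` [set wnil R] `|` \bigcup_(p in ~` S)
      [set q : walk R | exists e, edges q = rcons (edges p) e].
    move=> p [Sp minp].
    have [p0|[s [e pE]]] :
        edges p = [::] \/ exists s e, edges p = rcons s e.
      by case: (lastP (edges p)) => [|s e]; [left|right; exists s, e].
      by left; apply/val_inj.
    right; have := edgesP p; rewrite pE -cats1 is_walk_cat => /andP[ws _].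
    exists (Walk ws) => /=; last by exists e.
    move=> Ss; have sp : wle (Walk ws) p.
      by apply/wleP; exists [:: e]; rewrite cats1.
    have /(congr1 (fun q => size (edges q))) := minp _ Ss sp.
    by rewrite /= pE size_rcons => /n_Sn.
  apply; rewrite finite_setU; split=> //.
  by apply: bigcup_finite => // p _; apply: finite_extensions.
- by move=> p q [Sp _] [_ minq] pq; apply: minq.
- by move=> p [].
- move=> p; have [n] := ubnP (size (edges p)); elim: n p => // n IH p le Sp.
  have [|/existsNP[q]] := pselect (forall q, S q -> wle q p -> q = p).
    by move=> minp; exists p => //; apply: wle_refl.
  move=> /not_implyP[Sq] /not_implyP[qp neq].
  have [|b Bb bq] := IH q _ Sq; last by exists b => //; apply: wle_trans qp.
  by rewrite -ltnS (leq_trans _ le)// ltnS wle_size// eq_sym; apply/eqP.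
Qed.

End Walks.

(** * Almost automorphisms and the Higman-Thompson group *)

Section AlmostAutomorphisms.
Variables (G : graph) (R : vertex G).

(* The values of [arep_fun] outside [arep_dom] are irrelevant. *)
Record almost_aut_rep := AlmostAutRep {
  arep_dom : set (walk R);
  arep_cod : set (walk R);
  arep_fun : walk R -> walk R;
  arep_dom_cofinite : cofinite_subspace arep_dom;
  arep_cod_cofinite : cofinite_subspace arep_cod;
  arep_bij : set_bij arep_dom arep_cod arep_fun;
  arep_wle : forall p q, arep_dom p -> arep_dom q ->
    wle p q <-> wle (arep_fun p) (arep_fun q)
}.
Implicit Types (f g h : almost_aut_rep) (S : set (walk R)).

Definition arep_equiv f g : Prop := exists S,
  [/\ cofinite_subspace S, S `<=` arep_dom f, S `<=` arep_dom g
    & {in S, arep_fun f =1 arep_fun g}].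

Definition HT_rep f : Prop := exists2 B, is_basis (arep_dom f) B &
  forall b, B b -> tgt (arep_fun f b) = tgt b /\
  forall p : walk (tgt b),
    edges (arep_fun f (wcat p)) = edges (arep_fun f b) ++ edges p.

Let dom_cod f p : arep_dom f p -> arep_cod f (arep_fun f p).
Proof. by have [+ _ _] := arep_bij f; apply. Qed.

Let cod_dom f q : arep_cod f q -> exists2 p, arep_dom f p & arep_fun f p = q.
Proof. by have [_ _ +] := arep_bij f; apply. Qed.

Let dom_inj f p q : arep_dom f p -> arep_dom f q ->
  arep_fun f p = arep_fun f q -> p = q.
Proof.
by have [_ + _] := arep_bij f => inj fp fq; apply: inj; rewrite inE.
Qed.

Lemma arep_image_cofinite f S : S `<=` arep_dom f -> cofinite_subspace S ->
  cofinite_subspace (arep_fun f @` S).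
Proof.
move=> Sf [fS uS lS]; have [fC uC lC] := arep_cod_cofinite f; split.
- apply: (@sub_finite_set _ _ (~` arep_cod f `|` arep_fun f @` (~` S))).
    move=> q qS; have [fq|] := pselect (arep_cod f q); last by left.
    right; have [p fp pq] := cod_dom fq; exists p => // Sp; apply: qS.
    by exists p.
  by rewrite finite_setU; split=> //; apply: finite_image.
- move=> _ q [p Sp <-] pq; have fp := Sf _ Sp.
  have [p' fp' p'E] := cod_dom (uC _ _ (dom_cod fp) pq); subst q.
  by exists p' => //; apply: (uS p); last exact/(arep_wle fp fp').
- move=> q lq; have [p fp pE] := cod_dom (lC _ lq); subst q; exists p => //.
  apply: lS => p' pp'.
  have fp' : arep_dom f p' by have [_ u _] := arep_dom_cofinite f; apply: u pp'.
  by apply: (dom_inj fp' fp); apply: lq; exact/(arep_wle fp fp').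
Qed.

Fact arep_id_bij : set_bij [set: walk R] [set: walk R] idfun.
Proof. by split=> // p _; exists p. Qed.

Definition arep_id : almost_aut_rep :=
  AlmostAutRep (@cofinite_subspaceT G R) (@cofinite_subspaceT G R)
    arep_id_bij (fun p q _ _ => iff_refl (wle p q)).

Definition inv_fun f : walk R -> walk R :=
  'pinv_(fun=> wnil R) (arep_dom f) (arep_fun f).

Lemma inv_fun_bij f : set_bij (arep_cod f) (arep_dom f) (inv_fun f).
Proof. exact: bijpinv_bij (arep_bij f). Qed.

Lemma inv_fun_dom f q : arep_cod f q -> arep_dom f (inv_fun f q).
Proof. by have [+ _ _] := inv_fun_bij f; apply. Qed.

Lemma inv_funK f q : arep_cod f q -> arep_fun f (inv_fun f q) = q.
Proof.
move=> fq; have [_ _ sur] := arep_bij f.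
by apply: (surjpK _ sur); rewrite inE.
Qed.

Lemma fun_invK f p : arep_dom f p -> inv_fun f (arep_fun f p) = p.
Proof.
move=> fp; have fq := dom_cod fp.
by apply: (dom_inj (inv_fun_dom fq) fp); rewrite inv_funK.
Qed.

Fact inv_fun_wle f p q : arep_cod f p -> arep_cod f q ->
  wle p q <-> wle (inv_fun f p) (inv_fun f q).
Proof.
move=> fp fq.
by rewrite (arep_wle (inv_fun_dom fp) (inv_fun_dom fq)) !inv_funK.
Qed.

Definition arep_inv f : almost_aut_rep :=
  AlmostAutRep (arep_cod_cofinite f) (arep_dom_cofinite f)
    (inv_fun_bij f) (@inv_fun_wle f).

Definition comp_dom f g := arep_dom g `&` arep_fun g @^-1` arep_dom f.
Definition comp_cod f g := arep_fun f @` (arep_cod g `&` arep_dom f).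

Fact comp_dom_cofinite f g : cofinite_subspace (comp_dom f g).
Proof.
have -> : comp_dom f g = arep_fun (arep_inv g) @` (arep_cod g `&` arep_dom f).
  apply/seteqP; split=> [p [gp fgp]|_ [q [gq fq] <-]].
    exists (arep_fun g p); last exact: fun_invK.
    by split=> //; apply: dom_cod.
  by split; [apply: inv_fun_dom|rewrite /= inv_funK].
apply: arep_image_cofinite; first by move=> q [].
apply: cofinite_subspaceI; [exact: arep_cod_cofinite|exact: arep_dom_cofinite].
Qed.

Fact comp_cod_cofinite f g : cofinite_subspace (comp_cod f g).
Proof.
apply: arep_image_cofinite; first by move=> q [].
apply: cofinite_subspaceI; [exact: arep_cod_cofinite|exact: arep_dom_cofinite].
Qed.

Fact comp_bij f g :
  set_bij (comp_dom f g) (comp_cod f g) (arep_fun f \o arep_fun g).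
Proof.
split.
- move=> p [gp fgp]; exists (arep_fun g p) => //; split=> //; exact: dom_cod.
- move=> p q; rewrite !inE => -[gp fgp] [gq fgq] /= /(dom_inj fgp fgq).
  exact: dom_inj.
- move=> _ [q [gq fq] <-]; have [p gp pE] := cod_dom gq; subst q.
  by exists p.
Qed.

Fact comp_wle f g p q : comp_dom f g p -> comp_dom f g q ->
  wle p q <-> wle ((arep_fun f \o arep_fun g) p) ((arep_fun f \o arep_fun g) q).
Proof.
by move=> [gp fgp] [gq fgq]; rewrite (arep_wle gp gq) (arep_wle fgp fgq).
Qed.

Definition arep_comp f g : almost_aut_rep :=
  AlmostAutRep (comp_dom_cofinite f g) (comp_cod_cofinite f g)
    (comp_bij f g) (@comp_wle f g).

Lemma arep_equiv_refl f : arep_equiv f f.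
Proof. by exists (arep_dom f); split=> //; apply: arep_dom_cofinite. Qed.

Lemma arep_equiv_sym f g : arep_equiv f g -> arep_equiv g f.
Proof. by move=> [S [cS Sf Sg fg]]; exists S; split=> // p /fg. Qed.

Lemma arep_equiv_trans g f h :
  arep_equiv f g -> arep_equiv g h -> arep_equiv f h.
Proof.
move=> [S [cS Sf Sg fg]] [S' [cS' S'g S'h gh]]; exists (S `&` S').
split; [exact: cofinite_subspaceI|by move=> p [/Sf]|by move=> p [_ /S'h]|].
by move=> p; rewrite inE => -[Sp S'p]; rewrite fg ?gh// inE.
Qed.

Lemma arep_equiv_comp f f' g g' : arep_equiv f f' -> arep_equiv g g' ->
  arep_equiv (arep_comp f g) (arep_comp f' g').
Proof.
move=> [S [cS Sf Sf' ff']] [S' [cS' S'g S'g' gg']].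
exists (S' `&` arep_dom g `&` arep_fun g @^-1` S); split.
- pose D := arep_fun g @` (S' `&` arep_dom g) `&` S.
  have cD : cofinite_subspace D.
    apply: cofinite_subspaceI => //; apply: arep_image_cofinite.
      by move=> p [].
    by apply: cofinite_subspaceI => //; apply: arep_dom_cofinite.
  suff -> : S' `&` arep_dom g `&` arep_fun g @^-1` S =
      arep_fun (arep_inv g) @` D.
    by apply: arep_image_cofinite => // _ [[p [_ gp] <-] _]; apply: dom_cod.
  apply/seteqP; split=> [p [[S'p gp] Sgp]|_ [_ [[p [S'p gp] <-] Sgp] <-]].
    by exists (arep_fun g p); [split=> //; exists p|apply: fun_invK].
  by rewrite /= fun_invK.
- by move=> p [[S'p gp] Sgp]; split=> //; apply: Sf.
- move=> p [[S'p gp] Sgp]; split; first exact: S'g'.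
  by rewrite /= -gg' ?inE//; apply: Sf'.
- move=> p; rewrite inE => -[[S'p gp] Sgp] /=.
  by rewrite ff' ?inE// gg' ?inE.
Qed.

HB.instance Definition _ := gen_eqMixin almost_aut_rep.
HB.instance Definition _ := gen_choiceMixin almost_aut_rep.

Definition arep_equivb f g : bool := `[< arep_equiv f g >].

Fact arep_equivb_refl : reflexive arep_equivb.
Proof. by move=> f; apply/asboolP/arep_equiv_refl. Qed.
Fact arep_equivb_sym : symmetric arep_equivb.
Proof.
by move=> f g; apply/idP/idP => /asboolP /arep_equiv_sym h; apply/asboolP.
Qed.
Fact arep_equivb_trans : transitive arep_equivb.
Proof.
move=> g f h /asboolP fg /asboolP gh.
by apply/asboolP; apply: arep_equiv_trans fg gh.
Qed.

Canonical arep_equiv_rel :=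
  EquivRel arep_equivb arep_equivb_refl arep_equivb_sym arep_equivb_trans.

Definition almost_aut : Type := {eq_quot arep_equiv_rel}.
HB.instance Definition _ := Choice.on almost_aut.
HB.instance Definition _ := EqQuotient.on almost_aut.
Implicit Types x y z : almost_aut.

Definition aclass f : almost_aut := \pi_(almost_aut) f.

Definition aa_one : almost_aut := aclass arep_id.
Definition aa_mul x y : almost_aut := aclass (arep_comp (repr x) (repr y)).
Definition aa_inv x : almost_aut := aclass (arep_inv (repr x)).

Lemma aclassP f g : aclass f = aclass g <-> arep_equiv f g.
Proof. by split=> [/eqmodP/asboolP//|h]; apply/eqmodP/asboolP. Qed.

Lemma aclassK x : aclass (repr x) = x.
Proof. exact: reprK. Qed.

Lemma aclass_repr f : arep_equiv (repr (aclass f)) f.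
Proof. by apply/aclassP; rewrite aclassK. Qed.

Lemma aclass_mul f g : aa_mul (aclass f) (aclass g) = aclass (arep_comp f g).
Proof. by apply/aclassP/arep_equiv_comp; apply: aclass_repr. Qed.

Lemma arep_eq_on f g : arep_dom f `<=` arep_dom g ->
  (forall p, arep_dom f p -> arep_fun f p = arep_fun g p) -> arep_equiv f g.
Proof.
move=> fg e; exists (arep_dom f); split=> //; first exact: arep_dom_cofinite.
by move=> p; rewrite inE => /e.
Qed.

Fact aa_mulA : associative aa_mul.
Proof.
move=> x y z; rewrite -(aclassK x) -(aclassK y) -(aclassK z) !aclass_mul.
by apply/aclassP/arep_eq_on => //= p [[zp yp] xp].
Qed.
Fact aa_mul1 : left_id aa_one aa_mul.
Proof.
move=> x; rewrite -(aclassK x) aclass_mul.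
by apply/aclassP/arep_eq_on => //= p [].
Qed.
Fact aa_1mul : right_id aa_one aa_mul.
Proof.
move=> x; rewrite -(aclassK x) aclass_mul.
by apply/aclassP/arep_eq_on => //= p [].
Qed.
Fact aa_mulV : left_inverse aa_one aa_inv aa_mul.
Proof.
move=> x; rewrite -{2}(aclassK x) aclass_mul.
by apply/aclassP/arep_eq_on => //= p [xp _]; rewrite fun_invK.
Qed.
Fact aa_Vmul : right_inverse aa_one aa_inv aa_mul.
Proof.
move=> x; rewrite -{1}(aclassK x) aclass_mul.
by apply/aclassP/arep_eq_on => //= p [xp _]; rewrite inv_funK.
Qed.

HB.instance Definition _ :=
  isGroup.Build almost_aut aa_mulA aa_mul1 aa_1mul aa_mulV aa_Vmul.

Definition in_HT : {pred almost_aut} :=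
  fun x => `[< exists2 f, HT_rep f & aclass f = x >].

Lemma HT_repP f : HT_rep f <-> forall p, arep_dom f p ->
  tgt (arep_fun f p) = tgt p /\ forall q : walk (tgt p),
    edges (arep_fun f (wcat q)) = edges (arep_fun f p) ++ edges q.
Proof.
split=> [[B [_ _ _ Bdom] fB] p /Bdom [b Bb [r ->{p}]]|h]; last first.
  have [B bB] := cofinite_subspace_basis (arep_dom_cofinite f).
  by exists B => // b Bb; apply: h; case: bB => _ _ + _; apply.
have [tb cb] := fB b Bb; split.
  by rewrite /tgt /= !word_end_cat cb word_end_cat -!/(tgt _) tb.
move=> q; have wq : is_walk (tgt b) (edges r ++ edges q).
  by rewrite is_walk_cat (edgesP r) /= /tgt -word_end_cat; apply: edgesP.
have -> : wcat q = wcat (Walk wq) by apply: val_inj; rewrite /= catA.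
by rewrite !cb /= catA.
Qed.

Lemma HT_rep_comp f g : HT_rep f -> HT_rep g -> HT_rep (arep_comp f g).
Proof.
move=> /HT_repP hf /HT_repP hg; apply/HT_repP => p [gp fgp] /=.
have [tg cg] := hg p gp; have [tf cf] := hf _ fgp.
split=> [|q]; first by rewrite tf.
have wq : is_walk (tgt (arep_fun g p)) (edges q) by rewrite tg; apply: edgesP.
have -> : arep_fun g (wcat q) = wcat (Walk wq) by apply: val_inj; rewrite /= cg.
by rewrite cf.
Qed.

Lemma HT_rep_inv f : HT_rep f -> HT_rep (arep_inv f).
Proof.
move=> /HT_repP hf; apply/HT_repP => _ /cod_dom[p fp <-].
have [tf cf] := hf p fp; rewrite /= fun_invK//; split=> // q.
have wq : is_walk (tgt p) (edges q) by rewrite -tf; apply: edgesP.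
have -> : wcat q = arep_fun f (wcat (Walk wq)) by apply: val_inj; rewrite /= cf.
rewrite fun_invK//; have [_ u _] := arep_dom_cofinite f.
by apply: (u p) => //; exists (Walk wq).
Qed.

Lemma HT_rep_id : HT_rep arep_id.
Proof. by apply/HT_repP. Qed.

Lemma HT_group_closed : group_closed in_HT.
Proof.
split; first by apply/asboolP; exists arep_id; first exact: HT_rep_id.
move=> _ _ /asboolP[f hf <-] /asboolP[g hg <-].
apply/asboolP; exists (arep_comp f (arep_inv g)).
  exact/HT_rep_comp/HT_rep_inv.
rewrite -aclass_mul; congr (_ * _)%g.
rewrite -[LHS]mul1g -(mulVg (aclass g)) -mulgA -[RHS]mulg1.
congr (_ * _)%g; rewrite [LHS]aclass_mul.
by apply/aclassP/arep_eq_on => //= p [gp _]; rewrite inv_funK.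
Qed.

Definition HT : Type := {x : almost_aut | x \in in_HT}.
HB.instance Definition _ := [isSub of HT for @sval _ _].
HB.instance Definition _ := [Choice of HT by <:].
HB.instance Definition _ :=
  SubChoice_isSubGroup.Build almost_aut in_HT HT HT_group_closed.

End AlmostAutomorphisms.

(** * Leavitt path algebras over the integers *)

Section LeavittPathAlgebra.
Variable G : graph.
Local Open Scope ring_scope.

(* Non-commutative, non-unital ring expressions in the generators; the Leavitt
   path algebra is their quotient by the congruence generated by the axioms of
   (non-unital) rings and the defining relations. *)
Inductive lterm :=
| LVertex of vertex G
| LEdge of edge G
| LGhost of edge G
| LZero
| LOpp of lterm
| LAdd of lterm & lterm
| LMul of lterm & lterm.

Definition lsum (s : seq lterm) : lterm := foldr LAdd LZero s.

Definition out_edges (v : vertex G) : {fset edge G} :=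
  fset_set [set e | org e = v].

Inductive lcong : lterm -> lterm -> Prop :=
| lc_refl a : lcong a a
| lc_sym a b : lcong a b -> lcong b a
| lc_trans a b c : lcong a b -> lcong b c -> lcong a c
| lc_opp a a' : lcong a a' -> lcong (LOpp a) (LOpp a')
| lc_add a a' b b' : lcong a a' -> lcong b b' -> lcong (LAdd a b) (LAdd a' b')
| lc_mul a a' b b' : lcong a a' -> lcong b b' -> lcong (LMul a b) (LMul a' b')
| lc_addA a b c : lcong (LAdd a (LAdd b c)) (LAdd (LAdd a b) c)
| lc_addC a b : lcong (LAdd a b) (LAdd b a)
| lc_add0 a : lcong (LAdd LZero a) a
| lc_addN a : lcong (LAdd (LOpp a) a) LZero
| lc_mulA a b c : lcong (LMul a (LMul b c)) (LMul (LMul a b) c)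
| lc_mulDl a b c : lcong (LMul (LAdd a b) c) (LAdd (LMul a c) (LMul b c))
| lc_mulDr a b c : lcong (LMul a (LAdd b c)) (LAdd (LMul a b) (LMul a c))
| lc_vertexI v : lcong (LMul (LVertex v) (LVertex v)) (LVertex v)
| lc_vertexO v w : v != w -> lcong (LMul (LVertex v) (LVertex w)) LZero
| lc_ghost_edgeO e f : e != f -> lcong (LMul (LGhost e) (LEdge f)) LZero
| lc_ghost_edge e : lcong (LMul (LGhost e) (LEdge e)) (LVertex (ter e))
| lc_org_edge e : lcong (LMul (LVertex (org e)) (LEdge e)) (LEdge e)
| lc_edge_ter e : lcong (LMul (LEdge e) (LVertex (ter e))) (LEdge e)
| lc_ter_ghost e : lcong (LMul (LVertex (ter e)) (LGhost e)) (LGhost e)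
| lc_ghost_org e : lcong (LMul (LGhost e) (LVertex (org e))) (LGhost e)
| lc_vertex_sum v : out_edges v != fset0 ->
    lcong (LVertex v) (lsum [seq LMul (LEdge e) (LGhost e) | e <- out_edges v]).

Fixpoint lterm_star (a : lterm) : lterm :=
  match a with
  | LVertex v => LVertex v
  | LEdge e => LGhost e
  | LGhost e => LEdge e
  | LZero => LZero
  | LOpp a => LOpp (lterm_star a)
  | LAdd a b => LAdd (lterm_star a) (lterm_star b)
  | LMul a b => LMul (lterm_star b) (lterm_star a)
  end.

Lemma lterm_starK : involutive lterm_star.
Proof. by elim=> //= [a ->|a -> b ->|a -> b ->]. Qed.

Lemma lcong_star a b : lcong a b -> lcong (lterm_star a) (lterm_star b).
Proof.
elim=> //=; try by (move=> *; constructor; rewrite // eq_sym).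
- by move=> a' b' c _ h1 _ h2; apply: lc_trans h1 h2.
- by move=> a' b' c; apply/lc_sym/lc_mulA.
- move=> v nz; apply: lc_trans (lc_vertex_sum nz) _.
  elim: (enum_fset (out_edges v)) => /= [|e s IH]; first exact: lc_refl.
  by apply: lc_add; first exact: lc_refl.
Qed.

HB.instance Definition _ := gen_eqMixin lterm.
HB.instance Definition _ := gen_choiceMixin lterm.

Definition lcongb (a b : lterm) : bool := `[< lcong a b >].

Fact lcongb_refl : reflexive lcongb.
Proof. by move=> a; apply/asboolP/lc_refl. Qed.
Fact lcongb_sym : symmetric lcongb.
Proof. by move=> a b; apply/idP/idP => /asboolP h; apply/asboolP/lc_sym. Qed.
Fact lcongb_trans : transitive lcongb.
Proof.
by move=> b a c /asboolP ab /asboolP bc; apply/asboolP/(lc_trans ab bc).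
Qed.

Canonical lcong_rel := EquivRel lcongb lcongb_refl lcongb_sym lcongb_trans.

Definition leavitt : Type := {eq_quot lcong_rel}.
HB.instance Definition _ := Choice.on leavitt.
HB.instance Definition _ := EqQuotient.on leavitt.

Definition lclass (a : lterm) : leavitt := \pi_(leavitt) a.

Lemma lclassP a b : lclass a = lclass b <-> lcong a b.
Proof. by split=> [/eqmodP/asboolP//|h]; apply/eqmodP/asboolP. Qed.

Lemma lclassK (x : leavitt) : lclass (repr x) = x.
Proof. exact: reprK. Qed.

Lemma lclass_repr a : lcong (repr (lclass a)) a.
Proof. by apply/lclassP; rewrite lclassK. Qed.

Lemma leavittW (P : leavitt -> Prop) :
  (forall a, P (lclass a)) -> forall x, P x.
Proof. by move=> h x; rewrite -(lclassK x). Qed.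

Definition lzero : leavitt := lclass LZero.
Definition lopp (x : leavitt) : leavitt := lclass (LOpp (repr x)).
Definition ladd (x y : leavitt) : leavitt := lclass (LAdd (repr x) (repr y)).
Definition lmul (x y : leavitt) : leavitt := lclass (LMul (repr x) (repr y)).
Definition lstar (x : leavitt) : leavitt := lclass (lterm_star (repr x)).

Lemma lclass_opp a : lopp (lclass a) = lclass (LOpp a).
Proof. by apply/lclassP/lc_opp/lclass_repr. Qed.
Lemma lclass_add a b : ladd (lclass a) (lclass b) = lclass (LAdd a b).
Proof. by apply/lclassP/lc_add; apply: lclass_repr. Qed.
Lemma lclass_mul a b : lmul (lclass a) (lclass b) = lclass (LMul a b).
Proof. by apply/lclassP/lc_mul; apply: lclass_repr. Qed.
Lemma lclass_star a : lstar (lclass a) = lclass (lterm_star a).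
Proof. by apply/lclassP/lcong_star/lclass_repr. Qed.

Fact laddA : associative ladd.
Proof.
elim/leavittW=> a; elim/leavittW=> b; elim/leavittW=> c.
by rewrite !lclass_add; apply/lclassP/lc_addA.
Qed.
Fact laddC : commutative ladd.
Proof.
elim/leavittW=> a; elim/leavittW=> b.
by rewrite !lclass_add; apply/lclassP/lc_addC.
Qed.
Fact ladd0 : left_id lzero ladd.
Proof. by elim/leavittW=> a; rewrite lclass_add; apply/lclassP/lc_add0. Qed.
Fact laddN : left_inverse lzero lopp ladd.
Proof.
by elim/leavittW=> a; rewrite lclass_opp lclass_add; apply/lclassP/lc_addN.
Qed.

HB.instance Definition _ :=
  GRing.isZmodule.Build leavitt laddA laddC ladd0 laddN.

Local Infix "**" := lmul (at level 40, left associativity).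

Lemma lmulA : associative lmul.
Proof.
elim/leavittW=> a; elim/leavittW=> b; elim/leavittW=> c.
by rewrite !lclass_mul; apply/lclassP/lc_mulA.
Qed.
Lemma lmulDl : left_distributive lmul +%R.
Proof.
elim/leavittW=> a; elim/leavittW=> b; elim/leavittW=> c.
rewrite [_ + _]lclass_add !lclass_mul [_ + _]lclass_add.
by apply/lclassP/lc_mulDl.
Qed.
Lemma lmulDr : right_distributive lmul +%R.
Proof.
elim/leavittW=> a; elim/leavittW=> b; elim/leavittW=> c.
rewrite [_ + _]lclass_add !lclass_mul [_ + _]lclass_add.
by apply/lclassP/lc_mulDr.
Qed.

Lemma lstarK : involutive lstar.
Proof. by elim/leavittW=> a; rewrite !lclass_star lterm_starK. Qed.
Lemma lstarM x y : lstar (x ** y) = lstar y ** lstar x.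
Proof.
elim/leavittW: x => a; elim/leavittW: y => b.
by rewrite lclass_mul !lclass_star lclass_mul.
Qed.
Lemma lstarD x y : lstar (x + y) = lstar x + lstar y.
Proof.
elim/leavittW: x => a; elim/leavittW: y => b.
by rewrite [lclass a + _]lclass_add !lclass_star /= -lclass_add.
Qed.

Lemma lmul0 x : x ** 0 = 0.
Proof. by apply: (@addrI _ (x ** 0)); rewrite -lmulDr !addr0. Qed.
Lemma l0mul x : 0 ** x = 0.
Proof. by apply: (@addrI _ (0 ** x)); rewrite -lmulDl !addr0. Qed.
Lemma lstar0 : lstar 0 = 0.
Proof. by rewrite lclass_star. Qed.

Lemma additive_mulrz (f : leavitt -> leavitt) (n : int) :
  {morph f : x y / x + y} -> {morph f : x / x *~ n}.
Proof.
move=> fD; have f0 : f 0 = 0.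
  by apply: (@addrI _ (f 0)); rewrite -fD !addr0.
pose g : {additive leavitt -> leavitt} :=
  HB.pack f (GRing.isNmodMorphism.Build _ _ f (f0, fD)).
exact: (raddfMz g).
Qed.

Lemma lmulzl x y (n : int) : (x *~ n) ** y = (x ** y) *~ n.
Proof. by apply: (@additive_mulrz (lmul^~ y)) => a b; apply: lmulDl. Qed.
Lemma lmulzr x y (n : int) : x ** (y *~ n) = (x ** y) *~ n.
Proof. by apply: (@additive_mulrz (lmul x)) => a b; apply: lmulDr. Qed.
Lemma lstarz x (n : int) : lstar (x *~ n) = lstar x *~ n.
Proof. by apply: additive_mulrz; apply: lstarD. Qed.

Definition lvertex (v : vertex G) : leavitt := lclass (LVertex v).
Definition ledge (e : edge G) : leavitt := lclass (LEdge e).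

Definition lword (v : vertex G) (s : seq (edge G)) : leavitt :=
  if s is e :: s' then foldl (fun x f => x ** ledge f) (ledge e) s'
  else lvertex v.

Definition lpath v (p : walk v) : leavitt := lword v (edges p).

Lemma lstar_vertex v : lstar (lvertex v) = lvertex v.
Proof. by rewrite lclass_star. Qed.
Lemma lvertexI v : lvertex v ** lvertex v = lvertex v.
Proof. by rewrite lclass_mul; apply/lclassP/lc_vertexI. Qed.
Lemma lorg_edge e : lvertex (org e) ** ledge e = ledge e.
Proof. by rewrite lclass_mul; apply/lclassP/lc_org_edge. Qed.
Lemma ledge_ter e : ledge e ** lvertex (ter e) = ledge e.
Proof. by rewrite lclass_mul; apply/lclassP/lc_edge_ter. Qed.
Lemma lghost_edge e : lstar (ledge e) ** ledge e = lvertex (ter e).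
Proof.
by rewrite lclass_star lclass_mul; apply/lclassP/lc_ghost_edge.
Qed.
Lemma lghost_edgeO e f : e != f -> lstar (ledge e) ** ledge f = 0.
Proof.
by move=> ef; rewrite lclass_star lclass_mul; apply/lclassP/lc_ghost_edgeO.
Qed.

Lemma lword_rcons v s e : is_walk v (rcons s e) ->
  lword v (rcons s e) = lword v s ** ledge e.
Proof.
case: s => [|f s]; last by rewrite /= -cats1 foldl_cat.
by rewrite /= andbT => /eqP <-; rewrite lorg_edge.
Qed.

Lemma lvertex_word v s : is_walk v s -> lvertex v ** lword v s = lword v s.
Proof.
elim/last_ind: s => [|s e IH] ws; first exact: lvertexI.
rewrite lword_rcons// lmulA IH//.
by move: ws; rewrite -cats1 is_walk_cat => /andP[].
Qed.

Lemma lword_end v s : is_walk v s -> lword v s ** lvertex (word_end v s) = lword v s.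
Proof.
elim/last_ind: s => [|s e _] ws; first exact: lvertexI.
by rewrite lword_rcons// -lmulA /word_end map_rcons last_rcons ledge_ter.
Qed.

Lemma lword_cat v s t : is_walk v (s ++ t) ->
  lword v (s ++ t) = lword v s ** lword (word_end v s) t.
Proof.
elim/last_ind: t => [|t e IH]; first by rewrite cats0 => /lword_end ->.
rewrite -rcons_cat => w; rewrite lword_rcons//.
have w1 : is_walk v (s ++ t) by move: w; rewrite -cats1 is_walk_cat => /andP[].
have w2 : is_walk (word_end v s) (rcons t e).
  by move: w; rewrite rcons_cat is_walk_cat => /andP[].
by rewrite IH// lword_rcons// lmulA.
Qed.

Section Rooted.
Variable R : vertex G.
Implicit Types (p q : walk R).

(* The Z-submodule generated by the elements p q^* with T(p) = T(q). *)
Definition rooted_leavitt : set leavitt := [set x |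
  exists2 s : seq (int * (walk R * walk R)),
    {in s, forall i, tgt i.2.1 = tgt i.2.2} &
    x = \sum_(i <- s) (lpath i.2.1 ** lstar (lpath i.2.2)) *~ i.1].

Lemma rooted0 : rooted_leavitt 0.
Proof. by exists [::]; rewrite ?big_nil. Qed.

Lemma rootedD x y : rooted_leavitt x -> rooted_leavitt y ->
  rooted_leavitt (x + y).
Proof.
move=> [s ss ->] [t tt ->]; exists (s ++ t); last by rewrite big_cat.
by move=> i; rewrite mem_cat => /orP[/ss|/tt].
Qed.

Lemma rootedZ x (n : int) : rooted_leavitt x -> rooted_leavitt (x *~ n).
Proof.
move=> [s ss ->]; exists [seq (i.1 * n, i.2) | i <- s].
  by move=> _ /mapP[i /ss ? ->].
rewrite big_map mulrz_suml; apply: eq_bigr => i _.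
by rewrite mulrzA.
Qed.

Lemma rooted_gen p q : tgt p = tgt q ->
  rooted_leavitt (lpath p ** lstar (lpath q)).
Proof.
move=> pq; exists [:: (1, (p, q))]; last by rewrite big_seq1 mulr1z.
by move=> i; rewrite inE => /eqP ->.
Qed.

Lemma rooted_ind (P : leavitt -> Prop) : P 0 ->
  (forall x y, P x -> P y -> P (x + y)) ->
  (forall x (n : int), P x -> P (x *~ n)) ->
  (forall p q, tgt p = tgt q -> P (lpath p ** lstar (lpath q))) ->
  forall x, rooted_leavitt x -> P x.
Proof.
move=> P0 PD PZ Pg _ [s ss ->]; rewrite big_seq_cond.
by elim/big_ind: _ => // i; rewrite andbT => /ss ?; apply/PZ/Pg.
Qed.

Lemma lword_star_word v s : is_walk v s ->
  lstar (lword v s) ** lword v s = lvertex (word_end v s).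
Proof.
elim/last_ind: s => [|s e IH] ws; first by rewrite lstar_vertex lvertexI.
have ws' : is_walk v s by move: ws; rewrite -cats1 is_walk_cat => /andP[].
have te : word_end v s = org e.
  by move: ws; rewrite -cats1 is_walk_cat /= andbT => /andP[_ /eqP].
rewrite lword_rcons// lstarM -lmulA (lmulA _ _ (ledge e)) IH// te lorg_edge.
by rewrite lghost_edge /word_end map_rcons last_rcons.
Qed.

Lemma lword_star_neq v s e f s' t' : e != f ->
  is_walk v (s ++ e :: s') -> is_walk v (s ++ f :: t') ->
  lstar (lword v (s ++ e :: s')) ** lword v (s ++ f :: t') = 0.
Proof.
move=> ef ws wt; rewrite !lword_cat//.
move: ws wt; rewrite !is_walk_cat => /andP[wss we] /andP[_ wf].
rewrite lstarM -lmulA (lmulA _ (lword v s)) lword_star_word//.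
rewrite lvertex_word// -(cat1s e) -(cat1s f) !lword_cat//= lstarM -lmulA.
by rewrite (lmulA _ (ledge f)) lghost_edgeO// l0mul lmul0.
Qed.

Lemma wle_trichotomy p q : [\/ wle p q, wle q p
  | lstar (lpath p) ** lpath q = 0].
Proof.
have H (u : seq (edge G)) s t : is_walk R (u ++ s) -> is_walk R (u ++ t) ->
  [\/ exists r, t = s ++ r, exists r, s = t ++ r
    | lstar (lword R (u ++ s)) ** lword R (u ++ t) = 0].
  elim: s u t => [|e s IH] u [|f t] ws wt.
  - by constructor 1; exists [::].
  - by constructor 1; exists (f :: t).
  - by constructor 2; exists (e :: s).
  - have [ef|ef] := eqVneq e f; last by constructor 3; apply: lword_star_neq.
    subst f.
    have := IH (rcons u e) t; rewrite !cat_rcons => /(_ ws wt).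
    case=> [[r ->]|[r ->]|->]; last by constructor 3.
      by constructor 1; exists r.
    by constructor 2; exists r.
have := H [::] _ _ (edgesP p) (edgesP q).
by case=> [h|h|h]; [constructor 1|constructor 2|constructor 3] => //;
  apply/wleP.
Qed.

Lemma rooted_star x : rooted_leavitt x -> rooted_leavitt (lstar x).
Proof.
move=> rx; elim/rooted_ind: x / rx => [|x1 x2 h1 h2|x n h|p q pq].
- by rewrite lstar0; apply: rooted0.
- by rewrite lstarD; apply: rootedD.
- by rewrite lstarz; apply: rootedZ.
- by rewrite lstarM lstarK; apply: rooted_gen.
Qed.

Lemma rooted_genM p q p' q' : tgt p = tgt q -> tgt p' = tgt q' -> wle q p' ->
  rooted_leavitt ((lpath p ** lstar (lpath q)) ** (lpath p' ** lstar (lpath q'))).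
Proof.
move=> pq pq' /wleP[r rE].
have := edgesP p'; rewrite rE is_walk_cat => /andP[wq wr].
have wpr : is_walk R (edges p ++ r) by rewrite is_walk_cat edgesP -/(tgt p) pq.
have -> : (lpath p ** lstar (lpath q)) ** (lpath p' ** lstar (lpath q')) =
    lpath (Walk wpr) ** lstar (lpath q').
  rewrite lmulA; congr (_ ** _); rewrite -lmulA /lpath /= rE.
  rewrite lword_cat -?rE ?edgesP// (lmulA (lstar _)) lword_star_word//.
  by rewrite lvertex_word// lword_cat// -/(tgt p) pq.
apply: rooted_gen; rewrite -pq' /tgt rE !word_end_cat; congr word_end.
exact: pq.
Qed.

Lemma rootedM x y : rooted_leavitt x -> rooted_leavitt y ->
  rooted_leavitt (x ** y).
Proof.
move=> rx ry; elim/rooted_ind: x / rx => [|x1 x2 h1 h2|x n h|p q pq].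
- by rewrite l0mul; apply: rooted0.
- by rewrite lmulDl; apply: rootedD.
- by rewrite lmulzl; apply: rootedZ.
elim/rooted_ind: y / ry => [|y1 y2 h1 h2|y n h|p' q' pq'].
- by rewrite lmul0; apply: rooted0.
- by rewrite lmulDr; apply: rootedD.
- by rewrite lmulzr; apply: rootedZ.
have [h|h|h] := wle_trichotomy q p'.
- exact: rooted_genM.
- rewrite -[X in rooted_leavitt X]lstarK; apply: rooted_star.
  by rewrite !lstarM !lstarK; apply: rooted_genM.
- by rewrite lmulA -(lmulA (lpath p)) h lmul0 l0mul; apply: rooted0.
Qed.

Lemma rooted1 : rooted_leavitt (lvertex R).
Proof.
have := @rooted_gen (wnil R) (wnil R) erefl.
by rewrite /lpath /= lstar_vertex lvertexI.
Qed.

Lemma rooted_1mul x : rooted_leavitt x -> lvertex R ** x = x.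
Proof.
move=> rx; elim/rooted_ind: x / rx => [|x1 x2 h1 h2|x n h|p q pq].
- exact: lmul0.
- by rewrite lmulDr h1 h2.
- by rewrite lmulzr h.
- by rewrite lmulA lvertex_word ?edgesP.
Qed.

Lemma rooted_mul1 x : rooted_leavitt x -> x ** lvertex R = x.
Proof.
move=> rx; rewrite -[LHS]lstarK lstarM lstar_vertex rooted_1mul ?lstarK//.
exact: rooted_star.
Qed.

Definition is_unitary (x : leavitt) : Prop :=
  [/\ rooted_leavitt x, x ** lstar x = lvertex R & lstar x ** x = lvertex R].

Definition unitary : Type := {x : leavitt | `[< is_unitary x >]}.
HB.instance Definition _ := [isSub of unitary for @sval _ _].
HB.instance Definition _ := [Choice of unitary by <:].

Lemma unitaryP (u : unitary) : is_unitary (val u).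
Proof. exact/asboolP/(valP u). Qed.

Definition mk_unitary x (ux : is_unitary x) : unitary :=
  exist _ x (introT (asboolP _) ux).

Fact is_unitary1 : is_unitary (lvertex R).
Proof.
by split; rewrite ?lstar_vertex ?lvertexI//; apply: rooted1.
Qed.

Fact is_unitaryV x : is_unitary x -> is_unitary (lstar x).
Proof. by move=> [rx h1 h2]; split; rewrite ?lstarK//; apply: rooted_star. Qed.

Fact is_unitaryM x y : is_unitary x -> is_unitary y -> is_unitary (x ** y).
Proof.
move=> [rx x1 x2] [ry y1 y2]; split; first exact: rootedM.
- rewrite lstarM lmulA -(lmulA x) y1 -lmulA rooted_1mul//.
  exact: rooted_star.
- by rewrite lstarM lmulA -(lmulA (lstar y)) x2 -lmulA rooted_1mul.
Qed.

Definition unitary_one : unitary := mk_unitary is_unitary1.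
Definition unitary_inv (u : unitary) : unitary :=
  mk_unitary (is_unitaryV (unitaryP u)).
Definition unitary_mul (u v : unitary) : unitary :=
  mk_unitary (is_unitaryM (unitaryP u) (unitaryP v)).

Fact unitary_mulA : associative unitary_mul.
Proof. by move=> u v w; apply: val_inj; apply: lmulA. Qed.
Fact unitary_mul1 : left_id unitary_one unitary_mul.
Proof.
by move=> u; apply: val_inj; apply: rooted_1mul; case: (unitaryP u).
Qed.
Fact unitary_1mul : right_id unitary_one unitary_mul.
Proof.
by move=> u; apply: val_inj; apply: rooted_mul1; case: (unitaryP u).
Qed.
Fact unitary_mulV : left_inverse unitary_one unitary_inv unitary_mul.
Proof. by move=> u; apply: val_inj; case: (unitaryP u). Qed.
Fact unitary_Vmul : right_inverse unitary_one unitary_inv unitary_mul.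
Proof. by move=> u; apply: val_inj; case: (unitaryP u). Qed.

HB.instance Definition _ := isGroup.Build unitary
  unitary_mulA unitary_mul1 unitary_1mul unitary_mulV unitary_Vmul.

Definition diagonal_unitary : {pred unitary} := fun u =>
  `[< exists (B : {fset walk R}) (kappa : walk R -> int),
        [/\ finite_maximal_basis [set` B],
            forall b, b \in B -> kappa b = 1 \/ kappa b = -1
          & val u = \sum_(b <- B) (lpath b ** lstar (lpath b)) *~ kappa b] >].

End Rooted.
End LeavittPathAlgebra.

Arguments diagonal_unitary {G} R.

(* Main.v *)
From HB Require Import structures.
From mathcomp Require Import all_boot all_order all_algebra finmap.
From mathcomp Require Import all_classical.
Require Import Defs.

(** The key point is that a unitary [u] sends every path [p] that is long or
    ends in a sink to a path up to sign.  For such [p], the product [u p] is an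
    integer combination [\sum_s c_s s] of paths ending where [p] ends, and
    unitarity gives [(u p)^* (u p) = T(p)].  The products [s^* t] with [s != t]
    are [0], or nonempty paths or their adjoints; comparing the "diagonal" parts
    on both sides gives [\sum_s c_s ^ 2 = 1], so [u p = s] or [u p = - s] for
    some path [s].  The map [p |-> s] is a Higman-Thompson representative; its
    germ depends multiplicatively on [u], and it is trivial exactly when [u] is
    diagonal.  Conversely [\sum_b phi(b) b^*] is a unitary with germ [phi].

    Diagonal parts are separated, and paths are told apart, by letting the
    Leavitt path algebra act on functions on paths modulo functions vanishing on
    all long paths and on all paths to sinks. *)

Set Implicit Arguments.
Unset Strict Implicit.
Unset Printing Implicit Defensive.
Import Order.TTheory GRing.Theory Num.Theory.
Local Open Scope classical_set_scope.
Local Open Scope ring_scope.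

Local Infix "**" := lmul (at level 40, left associativity).

(** * Action of the Leavitt path algebra on kernels modulo negligible ones *)

Section Action.
Variable G : graph.
Local Notation word := (seq (edge G)).

(* Matrices indexed by paths: the operators act on the first path (a vertex and
   a word), and the last word is a column index that they do not touch. *)
Definition kernel := vertex G -> word -> word -> int.

Fixpoint act (a : lterm G) (f : kernel) : kernel := fun v s y =>
  match a with
  | LVertex w => if v == w then f v s y else 0
  | LEdge e => if s is e' :: s' then
      if (v == org e) && (e' == e) then f (ter e) s' y else 0 else 0
  | LGhost e => if v == ter e then f (org e) (e :: s) y else 0
  | LZero => 0
  | LOpp a => - act a f v s y
  | LAdd a b => act a f v s y + act b f v s y
  | LMul a b => act a (act b f) v s y
  end.

Definition sink (v : vertex G) : Prop := forall e : edge G, org e <> v.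

(** Paths to sinks count as long because they cannot be prolonged: if only long paths counted, such
    paths would act as zero. The bound [n] is uniform in the column [y], and words that are not
    walks are ignored. *)
Definition negligible (f : kernel) : Prop := exists n : nat, forall v s y,
  is_walk v s -> (n <= size s)%N \/ sink (word_end v s) -> f v s y = 0.

Definition ksub (f g : kernel) : kernel := fun v s y => f v s y - g v s y.

Lemma act_linear a (m n : int) f g :
  act a (fun v s y => m * f v s y + n * g v s y) =
  (fun v s y => m * act a f v s y + n * act a g v s y).
Proof.
have Z : m * 0 + n * 0 = 0 :> int by rewrite !mulr0 addr0.
elim: a f g => [w|e|e||a IH|a IHa b IHb|a IHa b IHb] f g;
  apply/funext => v; apply/funext => s; apply/funext => y //=.
- by case: ifP; rewrite ?Z.
- by case: s => [|e' s]; rewrite ?Z//; case: ifP; rewrite ?Z.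
- by case: ifP; rewrite ?Z.
- by rewrite IH opprD -!mulrN.
- by rewrite IHa IHb !mulrDr addrACA.
- by rewrite IHb IHa.
Qed.

Lemma actD a f g : act a (fun v s y => f v s y + g v s y) =
  (fun v s y => act a f v s y + act a g v s y).
Proof.
have := act_linear a 1 1 f g.
under eq_fun do under eq_fun do under eq_fun do rewrite !mul1r.
by move=> ->; do 3 apply/funext => ?; rewrite !mul1r.
Qed.

Lemma actB a f g : act a (ksub f g) = ksub (act a f) (act a g).
Proof.
have := act_linear a 1 (-1) f g.
under eq_fun do under eq_fun do under eq_fun do rewrite mul1r mulN1r.
by rewrite /ksub => ->; do 3 apply/funext => ?; rewrite mul1r mulN1r.
Qed.

Lemma negligibleB f g : negligible f -> negligible g -> negligible (ksub f g).
Proof.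
move=> [m fm] [n gn]; exists (maxn m n) => v s y ws h; rewrite /ksub fm ?gn ?subr0//.
  by case: h; [rewrite geq_max => /andP[]; left|right].
by case: h; [rewrite geq_max => /andP[]; left|right].
Qed.

(** An edge or a ghost edge changes the length of the argument by one and keeps its endpoint, so
    only the bound can move, and only for edges, which strip a letter. *)
Lemma act_negligible a f : negligible f -> negligible (act a f).
Proof.
elim: a f => [w|e|e||a IH|a IHa b IHb|a IHa b IHb] f nf.
- have [n fn] := nf; exists n => v s y ws h /=.
  by case: ifP => // _; apply: fn.
- have [n fn] := nf; exists n.+1 => v [|e' s] y //= /andP[/eqP <- ws] h.
  by case: ifP => // /andP[_ /eqP <-]; apply: fn.
- have [n fn] := nf; exists n => v s y ws h /=.
  case: eqP => // ve; apply: fn; first by rewrite /= eqxx -ve.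
  by case: h => h; [left; apply: leqW|right; rewrite /word_end /= -ve].
- by exists 0.
- by have [n fn] := IH f nf; exists n => v s y ws h /=; rewrite fn ?oppr0.
- have [m fm] := IHa f nf; have [n fn] := IHb f nf.
  exists (maxn m n) => v s y ws h /=; rewrite fm ?fn//.
    by case: h; [rewrite geq_max => /andP[]; left|right].
  by case: h; [rewrite geq_max => /andP[]; left|right].
- exact/IHa/IHb.
Qed.

Lemma negligible_refl f : negligible (ksub f f).
Proof. by exists 0 => v s y _ _; rewrite /ksub subrr. Qed.

Lemma negligible_sym f g : negligible (ksub f g) -> negligible (ksub g f).
Proof.
by move=> [n h]; exists n => v s y ws hs; rewrite /ksub -opprB [_ - _]h ?oppr0.
Qed.

Lemma negligible_trans g f h :
  negligible (ksub f g) -> negligible (ksub g h) -> negligible (ksub f h).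
Proof.
move=> fg /negligible_sym gh; have [n e] := negligibleB fg gh.
exists n => v s y ws /(e v s y ws) <-.
by rewrite /ksub opprB addrA subrK.
Qed.

Lemma out_edgesP (v : vertex G) e : (e \in out_edges v) = (org e == v).
Proof.
rewrite /out_edges in_fset_set; last exact: locally_finite.
by apply/idP/eqP; rewrite inE.
Qed.

Lemma act_lsum (T : eqType) (l : seq T) (F : T -> lterm G) f v s y :
  act (lsum [seq F e | e <- l]) f v s y = \sum_(e <- l) act (F e) f v s y.
Proof. by elim: l => [|e l IH]; rewrite ?big_nil// big_cons /= IH. Qed.

(* Every relation of the Leavitt path algebra holds exactly in this action,
   except [v = \sum_e e e^*], which fails at the empty path of [v] only. *)
Lemma lcong_act a b : lcong a b ->
  forall f, negligible (ksub (act a f) (act b f)).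
Proof.
elim=> {a b} [a|a b _ IH|a b c _ IH1 _ IH2|a a' _ IH|a a' b b' _ IHa _ IHb|
  a a' b b' _ IHa _ IHb|a b c|a b|a|a|a b c|a b c|a b c|v|v w vw|e e' ee'|e|e|
  e|e|e|v nv] f.
- exact: negligible_refl.
- exact/negligible_sym/IH.
- exact: negligible_trans (IH1 f) (IH2 f).
- have [n h] := IH f; exists n => v s y ws /(h v s y ws) e.
  by rewrite /ksub /= -opprD [_ - _]e oppr0.
- have [m fm] := IHa f; have [n fn] := IHb f.
  exists (maxn m n) => v s y ws h; rewrite /ksub /= opprD addrACA.
  rewrite [X in X + _]fm ?[X in _ + X]fn ?addr0//.
    by case: h; [rewrite geq_max => /andP[]; left|right].
  by case: h; [rewrite geq_max => /andP[]; left|right].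
(* Replace [b] by [b'] first: [a] then acts on a negligible difference. *)
- apply: (@negligible_trans (act a (act b' f))); last exact: IHa.
  by rewrite /= -[X in negligible X]actB; apply/act_negligible/IHb.
- by exists 0 => v s y _ _; rewrite /ksub /= addrA subrr.
- by exists 0 => v s y _ _; rewrite /ksub /= [X in X - _]addrC subrr.
- by exists 0 => v s y _ _; rewrite /ksub /= add0r subrr.
- by exists 0 => v s y _ _; rewrite /ksub /= addNr subrr.
- by exists 0 => v s y _ _; rewrite /ksub /= subrr.
- by exists 0 => v s y _ _; rewrite /ksub /= subrr.
- by exists 0 => v s y _ _; rewrite /ksub /= actD subrr.
- exists 0 => v' s y _ _; rewrite /ksub /=; by case: eqP => //=; rewrite subrr.
- exists 0 => v' s y _ _; rewrite /ksub /= subr0.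
  by case: eqP => // ->; rewrite (negPf vw).
- exists 0 => v' s y _ _; rewrite /ksub /= subr0.
  by case: eqP => // _; rewrite (negPf ee') andbF.
- exists 0 => v' s y _ _; rewrite /ksub /= !eqxx /=.
  by case: eqP => [->|_]; rewrite subrr.
- exists 0 => v' [|e' s] y _ _; rewrite /ksub /=; first by case: ifP.
  by case: eqP; rewrite ?subrr.
- by exists 0 => v' [|e' s] y _ _; rewrite /ksub /= ?eqxx subrr.
- by exists 0 => v' s y _ _; rewrite /ksub /=; case: eqP; rewrite subrr.
- by exists 0 => v' s y _ _; rewrite /ksub /= eqxx subrr.
- exists 1 => v' s y ws h; rewrite /ksub /= act_lsum.
  case: s ws h => [_ [//|] h|e s /= /andP[/eqP <- ws] _].
    have [e ev] := fset0Pn _ nv; case: eqP => [vv|_].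
      by case: (h e); rewrite vv; apply/eqP; rewrite -out_edgesP.
    by rewrite big1 ?subr0// => i _ /=; case: ifP.
  case: eqP => [vE|ne].
    rewrite (bigD1_seq e) ?fset_uniq ?out_edgesP ?vE//= !eqxx /=.
    rewrite big1 ?addr0 ?subrr// => i ie.
    by rewrite [e == i]eq_sym (negPf ie) andbF.
  rewrite big_seq big1 ?subr0// => i; rewrite out_edgesP => /eqP iv /=.
  by rewrite iv; case: eqP ne => // ->.
Qed.
End Action.

(** * Faithfulness on paths and the sum of squares *)

Section Faithful.
Variable G : graph.
Local Notation word := (seq (edge G)).
Local Notation kernel := (kernel G).

(** An element of the algebra acts only up to negligible kernels; fixing a term [a] for it gives an
    honest operator, so sums and products can be computed exactly and compared once at the end. *)
Definition realizes (x : leavitt G) (F : kernel -> kernel) : Prop :=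
  exists a, x = lclass a /\ forall f v s z, act a f v s z = F f v s z.

Lemma realizes_unique x F F' f : realizes x F -> realizes x F' ->
  negligible (ksub (F f) (F' f)).
Proof.
move=> [a [-> aF]] [b [/lclassP ab bF]]; have [n h] := lcong_act ab f.
by exists n => v s z ws /(h v s z ws); rewrite /ksub aF bF.
Qed.

Lemma realizes0 : realizes 0 (fun _ _ _ _ => 0).
Proof. by exists (LZero G). Qed.

Lemma realizesD x y F F' : realizes x F -> realizes y F' ->
  realizes (x + y) (fun f v s z => F f v s z + F' f v s z).
Proof.
move=> [a [-> aF]] [b [-> bF]]; exists (LAdd a b).
by rewrite -lclass_add; split=> // f v s z /=; rewrite aF bF.
Qed.

Lemma realizesN x F : realizes x F -> realizes (- x) (fun f v s z => - F f v s z).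
Proof.
move=> [a [-> aF]]; exists (LOpp a).
by rewrite -lclass_opp; split=> // f v s z /=; rewrite aF.
Qed.

Lemma realizesM x y F F' : realizes x F -> realizes y F' ->
  realizes (x ** y) (F \o F').
Proof.
move=> [a [-> aF]] [b [-> bF]]; exists (LMul a b).
rewrite -lclass_mul; split=> // f v s z /=; rewrite -aF; congr (act a _ v s z).
by do 3 apply/funext => ?.
Qed.

Lemma realizes_mulrz x F (n : int) : realizes x F ->
  realizes (x *~ n) (fun f v s z => F f v s z *~ n).
Proof.
have nat (m : nat) : realizes x F ->
    realizes (x *+ m) (fun f v s z => F f v s z *+ m).
  move=> rx; elim: m => [|m IH]; first exact: realizes0.
  have [a [aE aF]] := realizesD rx IH; exists a; rewrite mulrS.
  by split=> // f v s z; rewrite mulrS.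
by case: n => n rx; [exact: nat|exact/realizesN/nat].
Qed.

Lemma realizes_sum (T : Type) (l : seq T) (x : T -> leavitt G) F :
  (forall i, realizes (x i) (F i)) ->
  realizes (\sum_(i <- l) x i) (fun f v s z => \sum_(i <- l) F i f v s z).
Proof.
move=> h; elim: l => [|i l IH].
  have [a [aE aF]] := realizes0; exists a; rewrite big_nil.
  by split=> // f v s z; rewrite big_nil.
have [a [aE aF]] := realizesD (h i) IH; exists a; rewrite big_cons.
by split=> // f v s z; rewrite big_cons.
Qed.

Lemma realizes_vertex w :
  realizes (lvertex w) (fun f v s z => if v == w then f v s z else 0).
Proof. by exists (LVertex w). Qed.

Lemma realizes_path R (p : walk R) :
  realizes (lpath p) (fun f v s z =>
    if (v == R) && prefix (edges p) s
    then f (tgt p) (drop (size (edges p)) s) z else 0).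
Proof.
rewrite /lpath /tgt; elim/last_ind: (edges p) (edgesP p) => [|t e IH] wt.
  have [a [aE aF]] := realizes_vertex R; exists a; split=> // f v s z.
  rewrite aF prefix0s drop0 andbT /word_end /=.
  by case: eqP => // ->.
have [wt' te] : is_walk R t /\ word_end R t = org e.
  by move: wt; rewrite -cats1 is_walk_cat /= andbT => /andP[? /eqP].
have re : realizes (ledge e) (act (LEdge e)) by exists (LEdge e).
rewrite lword_rcons//; have [a [aE aF]] := realizesM (IH wt') re.
exists a; split=> // f v s z; rewrite aF /=.
case: eqP => //= _; rewrite te eqxx /= /word_end map_rcons last_rcons size_rcons.
case: (boolP (prefix t s)) => [/prefixP[u ->]|npre]; last first.
  by case: ifP => // /prefixP[u sE]; rewrite sE cat_rcons prefix_prefix in npre.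
rewrite drop_size_cat// -cats1 prefix_catr// eqxx /=; case: u => [|e' u] //=.
rewrite prefix0s andbT [e == _]eq_sym; case: eqP => //= ->.
by rewrite -cat_rcons drop_size_cat// size_rcons.
Qed.

Lemma realizes_path_star R (p : walk R) :
  realizes (lstar (lpath p)) (fun f v s z =>
    if v == tgt p then f R (edges p ++ s) z else 0).
Proof.
rewrite /lpath /tgt; elim/last_ind: (edges p) (edgesP p) => [|t e IH] wt.
  rewrite lstar_vertex; have [a [aE aF]] := realizes_vertex R.
  exists a; split=> // f v s z; rewrite aF.
  by rewrite /word_end /=; case: eqP => // ->.
have [wt' te] : is_walk R t /\ word_end R t = org e.
  by move: wt; rewrite -cats1 is_walk_cat /= andbT => /andP[? /eqP].
rewrite lword_rcons// lstarM.
have re : realizes (lstar (ledge e)) (act (LGhost e)).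
  by exists (LGhost e); rewrite /ledge lclass_star.
have [a [aE aF]] := realizesM re (IH wt').
exists a; split=> // f v s z; rewrite aF /=.
by rewrite te eqxx /word_end map_rcons last_rcons cat_rcons.
Qed.

(** Supplies the test points: from every vertex there is a walk on which a negligible kernel with
    bound [n] must vanish. *)
Lemma deep_walk (v : vertex G) n : exists s, is_walk v s /\
  ((n <= size s)%N \/ sink (word_end v s)).
Proof.
elim: n => [|n [s [ws h]]]; first by exists [::]; split=> //; left.
have [sk|/existsNP[e /contrapT ev]] := pselect (sink (word_end v s)).
  by exists s; split=> //; right.
case: h => [ns|sk]; last by case: (sk e).
exists (rcons s e); rewrite -cats1 is_walk_cat ws /= ev eqxx; split=> //.
by left; rewrite size_cat addn1.
Qed.

(** The identity matrix on words; applying an operator to it reads off matrix entries. *)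
Definition delta_kernel : kernel := fun _ s z => (s == z)%:R.

Lemma is_walk_cat_tgt (R : vertex G) (p : walk R) s :
  is_walk (tgt p) s -> is_walk R (edges p ++ s).
Proof. by move=> ws; rewrite is_walk_cat edgesP. Qed.

(** For a deep walk [s] from the end of [p], the entry in row [p s] and column [s] is [m] for the
    left side, and [n] or [0] for the right side according to whether [q s = p s]. *)
Lemma lpath_mulrz_inj (R : vertex G) (p q : walk R) (m n : int) : m != 0 ->
  lpath p *~ m = lpath q *~ n -> p = q.
Proof.
move=> m0 pq; have rp := realizes_mulrz m (realizes_path p).
have rq := realizes_mulrz n (realizes_path q); rewrite -pq in rq.
have [N h] := realizes_unique delta_kernel rp rq.
have [s [ws hs]] := deep_walk (tgt p) N.
have := h R (edges p ++ s) s (is_walk_cat_tgt ws).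
rewrite /ksub /delta_kernel word_end_cat prefix_prefix eqxx drop_size_cat//= eqxx.
move=> e; apply: val_inj.
have {e} : 1 *~ m - (if prefix (edges q) (edges p ++ s)
    then (drop (size (edges q)) (edges p ++ s) == s)%:R else 0) *~ n = 0 :> int.
  by apply: e; case: hs => hs; [left; rewrite size_cat (leq_trans hs) ?leq_addl|right].
move=> /eqP; rewrite subr_eq0 intz; case: ifP => [/prefixP[t tE]|_]; last first.
  by rewrite mul0rz (negPf m0).
rewrite tE drop_size_cat//; case: (t =P s) => [ts _|_]; last by rewrite mul0rz (negPf m0).
(* Reversal turns the common suffix [s] into a common prefix, which cancels. *)
move: tE; rewrite ts => /(congr1 rev); rewrite !rev_cat => /eqP.
by rewrite eqseq_cat// => /andP[_ /eqP /(can_inj revK)].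
Qed.

(** Take the diagonal entry at a deep walk [s] from [w]. On the right it is [1]; on the left the
    pair [t], [t'] contributes [c t * c t'] only if [t s = t' s], that is, if [t = t']. *)
Lemma isometry_coef (R w : vertex G) (l : seq (walk R)) (c : walk R -> int) :
  uniq l -> {in l, forall s, tgt s = w} ->
  let x := \sum_(s <- l) lpath s *~ c s in
  lstar x ** x = lvertex w -> \sum_(s <- l) c s ^+ 2 = 1.
Proof.
move=> ul lw x xx.
have rx := realizes_sum l (fun s => realizes_mulrz (c s) (realizes_path s)).
have rx' := realizes_sum l (fun s => realizes_mulrz (c s) (realizes_path_star s)).
have xE : \sum_(s <- l) lstar (lpath s) *~ c s = lstar x.
  rewrite /x (big_morph _ (@lstarD G) (@lstar0 G)).
  by apply: eq_bigr => s _; rewrite lstarz.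
rewrite xE in rx'.
have := realizesM rx' rx; rewrite xx => rw.
have [N h] := realizes_unique delta_kernel rw (realizes_vertex w).
have [s [ws hs]] := deep_walk w N.
have := h w s s ws hs.
rewrite /ksub /= /delta_kernel !eqxx => /eqP; rewrite subr_eq0 => /eqP; rewrite mulr1n => <-.
rewrite !big_seq; apply: eq_bigr => t tl; rewrite lw// eqxx.
rewrite (bigD1_seq t)//= prefix_prefix drop_size_cat// eqxx big1 ?addr0.
  by rewrite -mulrzA intz expr2.
move=> t' tt'; case: ifP => [/prefixP[u uE]|_]; last by rewrite mul0rz.
rewrite uE drop_size_cat//; case: (u =P s) => [us|_]; last by rewrite mul0rz.
case/eqP: tt'; apply: val_inj.
move: uE; rewrite us => /(congr1 rev); rewrite !rev_cat => /eqP.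
by rewrite eqseq_cat// => /andP[_ /eqP /(can_inj revK) /esym].
Qed.

End Faithful.

(** * Deep paths and partitions of the unit *)

Section DeepPaths.
Variables (G : graph) (R : vertex G).
Implicit Types (p q : walk R) (x y : leavitt G).

Lemma leafP p : leaf p <-> sink (tgt p).
Proof.
split=> [lp e ep|sk q [r ->]].
  have we : is_walk (tgt p) [:: e] by rewrite /= ep eqxx.
  have /(congr1 (fun q => size (edges q))) := lp _ (ex_intro _ (Walk we) erefl).
  by rewrite /= size_cat addn1 => /esym/n_Sn.
case: r => -[|e r] wr; first by apply: val_inj; rewrite /= cats0.
by have /andP[/eqP /sk] := wr.
Qed.

(** These sets are cofinal among the cofinite subspaces and match the test walks of [negligible], by
    [leafP]. *)
Definition deep n : set (walk R) := [set p | (n <= size (edges p))%N \/ leaf p].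

Lemma deep_wle n p q : deep n p -> wle p q -> deep n q.
Proof.
move=> [np|lp] pq; last by right; rewrite (lp _ pq).
by left; have /wleP[s ->] := pq; rewrite size_cat (leq_trans np) ?leq_addr.
Qed.

Lemma finite_short n : finite_set [set p : walk R | (size (edges p) < n)%N].
Proof.
elim: n => [|n IH]; first by rewrite (_ : [set _ | _] = set0)// -subset0.
apply: (@sub_finite_set _ _ ([set wnil R] `|` \bigcup_(p in [set p | (size (edges p) < n)%N])
      [set q : walk R | exists e, edges q = rcons (edges p) e])).
  move=> p /= pn; case: {-1}(edges p) / lastP (erefl (edges p)) => [|s e] pE.
    by left; apply/val_inj.
  right; have := edgesP p; rewrite pE -cats1 is_walk_cat => /andP[ws _].
  exists (Walk ws) => /=; last by exists e.
  by rewrite pE size_rcons in pn.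
rewrite finite_setU; split=> //.
by apply: bigcup_finite => // p _; apply: finite_extensions.
Qed.

Lemma deep_cofinite n : cofinite_subspace (deep n).
Proof.
split; [|exact: deep_wle|by right].
apply: sub_finite_set (finite_short n) => p /= /not_orP[np _].
by rewrite ltnNge; apply/negP.
Qed.

Lemma cofinite_deep S : cofinite_subspace S -> exists n, deep n `<=` S.
Proof.
move=> [/finite_fsetP[F FE] uS lS].
(* One more than the length of the longest path in the complement. *)
exists (\max_(p <- F) size (edges p)).+1 => p [np|/lS//].
apply: contrapT => nSp; have pF : p \in F.
  by have : (~` S) p by []; rewrite FE.
by have := @leq_bigmax_seq _ (enum_fset F) xpredT (fun p => size (edges p))
  p pF isT; rewrite leqNgt np.
Qed.

Lemma lvertex_sum (v : vertex G) : ~ sink v ->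
  lvertex v = \sum_(e <- out_edges v) ledge e ** lstar (ledge e).
Proof.
move=> /existsNP[e /contrapT ev].
have nv : out_edges v != fset0.
  by apply/fset0Pn; exists e; rewrite out_edgesP ev.
have /lclassP := lc_vertex_sum nv; rewrite /lvertex => ->.
elim: (enum_fset _) => [|f l IH]; first by rewrite big_nil.
by rewrite big_cons /= -lclass_add IH lclass_star lclass_mul.
Qed.

Lemma lmul_suml (T : Type) (l : seq T) (P : pred T) (f : T -> leavitt G) x :
  (\sum_(i <- l | P i) f i) ** x = \sum_(i <- l | P i) f i ** x.
Proof. by apply: (big_morph (fun y => y ** x)) => [a b|]; [apply: lmulDl|apply: l0mul]. Qed.

Lemma lmul_sumr (T : Type) (l : seq T) (P : pred T) (f : T -> leavitt G) x :
  x ** (\sum_(i <- l | P i) f i) = \sum_(i <- l | P i) x ** f i.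
Proof. by apply: (big_morph (lmul x)) => [a b|]; [apply: lmulDr|apply: lmul0]. Qed.

Lemma lstar_sum (T : Type) (l : seq T) (P : pred T) (f : T -> leavitt G) :
  lstar (\sum_(i <- l | P i) f i) = \sum_(i <- l | P i) lstar (f i).
Proof. by apply: big_morph; [apply: lstarD|apply: lstar0]. Qed.

Lemma lpathM p (r : walk (tgt p)) : lpath (wcat r) = lpath p ** lpath r.
Proof. exact/lword_cat/(edgesP (wcat r)). Qed.

Lemma lpath_ter p : lpath p ** lvertex (tgt p) = lpath p.
Proof. exact/lword_end/edgesP. Qed.

Lemma lvertex_path (v : vertex G) (p : walk v) : lvertex v ** lpath p = lpath p.
Proof. exact/lvertex_word/edgesP. Qed.

Lemma lpath_star_path (v : vertex G) (p : walk v) :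
  lstar (lpath p) ** lpath p = lvertex (tgt p).
Proof. exact/lword_star_word/edgesP. Qed.

(** Total in [e], with default value [p] when [e] does not start at the end of [p], so that it can
    index sums over edges. *)
Definition extend p e : walk R := insubd p (rcons (edges p) e).

Lemma edges_extend p e : org e = tgt p -> edges (extend p e) = rcons (edges p) e.
Proof.
move=> ep; rewrite -[edges (extend p e)]/(val _) val_insubd.
by rewrite -cats1 is_walk_cat edgesP /= -/(tgt p) ep eqxx.
Qed.

(** Expand the vertex in the middle of [p p^*] into the sum of [e e^*] and iterate. Expansion stops
    at sinks, where the path is a leaf and hence already deep. *)
Lemma deep_partition k p : exists l : seq (walk R),
  (forall q, q \in l -> deep (size (edges p) + k) q) /\
  \sum_(q <- l) lpath q ** lstar (lpath q) = lpath p ** lstar (lpath p).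
Proof.
elim: k p => [|k IH] p.
  exists [:: p]; rewrite big_seq1; split=> // q; rewrite inE => /eqP ->.
  by left; rewrite addn0.
have [sk|nsk] := pselect (sink (tgt p)).
  exists [:: p]; rewrite big_seq1; split=> // q; rewrite inE => /eqP ->.
  by right; apply/leafP.
have [L hL] := choice IH.
exists (flatten [seq L (extend p e) | e <- out_edges (tgt p)]); split.
  move=> q /flattenP[l' /mapP[e + ->]]; rewrite out_edgesP => /eqP ep /(hL _).1.
  by rewrite edges_extend// size_rcons addSnnS.
rewrite big_flatten big_map -[X in _ = X ** _]lpath_ter lvertex_sum//.
rewrite lmul_sumr lmul_suml big_seq [RHS]big_seq; apply: eq_bigr => e.
rewrite out_edgesP => /eqP ep; rewrite (hL _).2.
have -> : lpath (extend p e) = lpath p ** ledge e.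
  rewrite /lpath edges_extend// lword_rcons//.
  by rewrite -cats1 is_walk_cat edgesP /= ep eqxx.
by rewrite lstarM !lmulA.
Qed.

Lemma unit_partition n : exists l : seq (walk R),
  (forall q, q \in l -> deep n q) /\
  \sum_(q <- l) lpath q ** lstar (lpath q) = lvertex R.
Proof.
have [l [ln lE]] := deep_partition n (wnil R); exists l; split=> //.
by rewrite lE /lpath /= lstar_vertex lvertexI.
Qed.

(** Multiply on the right by the unit, written as a sum of [p p^*] over deep [p]. *)
Lemma deep_ext n x y : x ** lvertex R = x -> y ** lvertex R = y ->
  (forall p, deep n p -> x ** lpath p = y ** lpath p) -> x = y.
Proof.
move=> xR yR xy; have [l [ln lE]] := unit_partition n.
rewrite -xR -yR -lE !lmul_sumr !big_seq; apply: eq_bigr => p /ln /xy e.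
by rewrite !lmulA e.
Qed.

End DeepPaths.

(** * Unitaries send deep paths to signed paths *)

Section SignedPaths.
Variables (G : graph) (R : vertex G).
Implicit Types (p q : walk R) (x y : leavitt G).

Definition is_sign (k : int) : Prop := k = 1 \/ k = -1.

Lemma is_signM k m : is_sign k -> is_sign m -> is_sign (k * m).
Proof. by move=> [->|->] [->|->]; rewrite ?mulN1r ?mul1r ?opprK; [left|right|right|left]. Qed.

Lemma is_sign_neq0 k : is_sign k -> k != 0.
Proof. by case=> ->. Qed.

Lemma mulrz_signK x k : is_sign k -> x *~ k *~ k = x.
Proof. by case=> ->; rewrite ?mulr1z// mulrN1z mulrN1z opprK. Qed.

Definition sends x p q : Prop :=
  tgt q = tgt p /\ exists2 k, is_sign k & x ** lpath p = lpath q *~ k.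

(** Here [r] is typed as a walk from the end of [p], so [q r] is not literally a [wcat]; the
    concatenation is therefore described through words. *)
Lemma lpath_cat v (p : walk v) (q q' : walk R) (r : walk (tgt p)) :
  tgt q = tgt p -> edges q' = edges q ++ edges r ->
  lpath q' = lpath q ** lpath r.
Proof.
move=> qp q'E; rewrite {1}/lpath q'E lword_cat -?q'E ?edgesP//.
by rewrite -/(tgt q) qp.
Qed.

Lemma sends_wcat x p q (r : walk (tgt p)) : sends x p q ->
  exists2 q' : walk R, edges q' = edges q ++ edges r & sends x (wcat r) q'.
Proof.
move=> [qp [k sk e]].
have wr : is_walk R (edges q ++ edges r).
  by rewrite is_walk_cat edgesP -/(tgt q) qp edgesP.
exists (Walk wr) => //; split; first by rewrite /tgt /= !word_end_cat -/(tgt q) qp.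
by exists k => //; rewrite (lpath_cat (q := q) (q' := Walk wr) (r := r))//
  lpathM lmulA e lmulzl.
Qed.

(** The image path is determined because distinct paths are never proportional. Injectivity in [p],
    for unitary [x], follows through [sends_star]. *)
Lemma sends_inj x p q q' : sends x p q -> sends x p q' -> q = q'.
Proof.
move=> [_ [k sk e]] [_ [k' _ e']].
by apply: (lpath_mulrz_inj (is_sign_neq0 sk)); rewrite -e; apply: e'.
Qed.

Lemma sends_wle x p p' q q' : sends x p q -> sends x p' q' -> wle p p' ->
  wle q q'.
Proof.
move=> pq pq' [r p'E]; subst p'; have [q2 q2E pq2] := sends_wcat r pq.
by apply/wleP; exists (edges r); rewrite (sends_inj pq' pq2).
Qed.

Lemma sends_star x p q : is_unitary R x -> sends x p q -> sends (lstar x) q p.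
Proof.
move=> [rx _ xx] [qp [k sk e]]; split=> //; exists k => //.
by rewrite -[LHS](mulrz_signK _ sk) -lmulzr -e lmulA xx lvertex_path.
Qed.

(** For a generator [p q^*] and a path [p'] at least as long as [q] or ending in a sink, [q^* p'] is
    zero or a path: no ghost edges remain. *)
Lemma rooted_mul_deep x : rooted_leavitt R x -> exists n, forall p, deep n p ->
  exists2 l : seq (walk R * int), {in l, forall i, tgt i.1 = tgt p} &
    x ** lpath p = \sum_(i <- l) lpath i.1 *~ i.2.
Proof.
move=> rx; elim/rooted_ind: x / rx => [|x y [m hx] [n hy]|x k [n hx]|p q pq].
- by exists 0 => p _; exists [::] => //; rewrite big_nil l0mul.
- exists (maxn m n) => p dp.
  have [|l lp lE] := hx p.
    by case: dp; [rewrite geq_max => /andP[]; left|right].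
  have [|l' lp' lE'] := hy p.
    by case: dp; [rewrite geq_max => /andP[]; left|right].
  exists (l ++ l'); last by rewrite lmulDl lE lE' big_cat.
  by move=> i; rewrite mem_cat => /orP[/lp|/lp'].
- exists n => p /hx[l lp lE]; exists [seq (i.1, i.2 * k) | i <- l].
    by move=> _ /mapP[i /lp ? ->].
  rewrite lmulzl lE big_map mulrz_suml; apply: eq_bigr => i _.
  by rewrite mulrzA.
exists (size (edges q)) => p' dp'; rewrite -lmulA.
have gen : wle q p' -> exists2 l : seq (walk R * int), {in l, forall i, tgt i.1 = tgt p'} &
    lpath p ** (lstar (lpath q) ** lpath p') = \sum_(i <- l) lpath i.1 *~ i.2.
  move=> [r ->].
  have wr : is_walk R (edges p ++ edges r).
    by rewrite is_walk_cat edgesP -/(tgt p) pq edgesP.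
  exists [:: (Walk wr, 1)].
    by move=> i; rewrite inE => /eqP -> /=; rewrite /tgt /= !word_end_cat -/(tgt p) pq.
  rewrite big_seq1 mulr1z lpathM (lmulA (lstar _)) lpath_star_path lvertex_path.
  by rewrite (lpath_cat (q := p) (q' := Walk wr) (r := r)).
have [qp|qp|->] := wle_trichotomy q p'; first exact: gen; last first.
  by exists [::] => //; rewrite big_nil lmul0.
(* If [p'] is a prefix of [q], depth forces equality: a proper prefix is too short, and a leaf has
   no proper extension. *)
have [qE|/(wle_size qp) lt] := eqVneq q p'.
  by apply: gen; rewrite qE; apply: wle_refl.
case: dp' => [le|lp']; first by rewrite ltnNge le in lt.
by move: lt; rewrite (lp' _ qp) ltnn.
Qed.

(** This is where integer coefficients matter: a nonzero square is at least [1], so it leaves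
    nothing for the other terms. *)
Lemma sum_sqr_eq1 (T : eqType) (l : seq T) (c : T -> int) : uniq l ->
  \sum_(s <- l) c s ^+ 2 = 1 -> exists s,
    [/\ s \in l, is_sign (c s) & forall t, t \in l -> t != s -> c t = 0].
Proof.
move=> ul e.
have [z|/existsNP[s /not_implyP[sl /eqP cs]]] := pselect (forall s, s \in l -> c s = 0).
  by move: e; rewrite big_seq big1 // => s /z ->; rewrite expr0n.
exists s; have := e; rewrite (bigD1_seq s)//=.
set r := (X in _ + X) => e'.
have r0 : 0 <= r by apply: sumr_ge0 => i _; apply: sqr_ge0.
have c1 : 1 <= c s ^+ 2 by rewrite -gtz0_ge1 exprn_even_gt0.
have cE : c s ^+ 2 = 1 by apply/eqP; rewrite eq_le c1 -e' lerDl r0.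
have rE : r = 0 by move: e'; rewrite cE => /(canRL (addKr _)); rewrite addNr.
split=> //; first by have /eqP := cE; rewrite sqrf_eq1 => /orP[]/eqP; [left|right].
move=> t tl ts; have /eqP := rE; rewrite psumr_eq0; last by move=> i _; apply: sqr_ge0.
by move=> /allP/(_ t tl); rewrite ts sqrf_eq0 => /eqP.
Qed.

Lemma unitary_sends x : is_unitary R x ->
  exists n, forall p, deep n p -> exists q, sends x p q.
Proof.
move=> [rx _ xx]; have [n h] := rooted_mul_deep rx; exists n => p /h[l lp lE].
(* A path may occur several times in [l]; its coefficients are collected, since [isometry_coef]
   requires distinct paths. *)
pose c s := \sum_(i <- l | i.1 == s) i.2.
have xE : x ** lpath p = \sum_(s <- undup [seq i.1 | i <- l]) lpath s *~ c s.
  rewrite lE; under [RHS]eq_bigr do rewrite /c mulrz_sumr.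
  rewrite (exchange_big_dep xpredT)//= big_seq [RHS]big_seq; apply: eq_bigr => i il.
  under [RHS]eq_bigl do rewrite eq_sym.
  rewrite -big_filter filter_pred1_uniq ?undup_uniq ?big_seq1//.
  by rewrite mem_undup map_f.
have lw : {in undup [seq i.1 | i <- l], forall s, tgt s = tgt p}.
  by move=> s; rewrite mem_undup => /mapP[i /lp ? ->].
have c1 : \sum_(s <- undup [seq i.1 | i <- l]) c s ^+ 2 = 1.
  apply: (isometry_coef (undup_uniq _) lw); rewrite -xE lstarM -lmulA.
  by rewrite (lmulA (lstar x)) xx lvertex_path lpath_star_path.
have [s [sl cs s0]] := sum_sqr_eq1 (undup_uniq _) c1.
exists s; split; first exact: lw; exists (c s) => //.
rewrite xE (bigD1_seq s) ?undup_uniq//= big_seq_cond big1 ?addr0//.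
by move=> t /andP[tl ts]; rewrite s0.
Qed.

End SignedPaths.

(** * Correspondence between unitaries and Higman-Thompson representatives *)

Section Represents.
Variables (G : graph) (R : vertex G).
Implicit Types (p q : walk R) (x y : leavitt G) (f g : almost_aut_rep R).

(** Agreement is asked only on some cofinite subspace, which makes this a property of the germ of
    [f]. *)
Definition represents x f : Prop := exists S, [/\ cofinite_subspace S,
  S `<=` arep_dom f & forall p, S p -> sends x p (arep_fun f p)].

Lemma represents_equiv x f g : arep_equiv f g -> represents x f -> represents x g.
Proof.
move=> [S [cS Sf Sg fg]] [S' [cS' S'f h]]; exists (S `&` S').
split; [exact: cofinite_subspaceI|by move=> p [/Sg]|move=> p [Sp S'p]].
by rewrite -fg ?inE//; apply: h.
Qed.

Lemma represents_inj x f g : represents x f -> represents x g -> arep_equiv f g.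
Proof.
move=> [S [cS Sf hf]] [S' [cS' S'g hg]]; exists (S `&` S').
split; [exact: cofinite_subspaceI|by move=> p [/Sf]|by move=> p [_ /S'g]|].
by move=> p; rewrite inE => -[/hf pf /hg pg]; apply: sends_inj pf pg.
Qed.

Lemma represents_comp x y f g : represents x f -> represents y g ->
  represents (x ** y) (arep_comp f g).
Proof.
move=> [S [cS Sf hf]] [S' [cS' S'g hg]].
exists (S' `&` arep_fun g @^-1` S); split.
(* The preimage under [g] is written as an image under its inverse, since cofiniteness is known for
   images. *)
- rewrite (_ : _ `&` _ = arep_fun (arep_inv g) @` (arep_fun g @` S' `&` S)).
    apply: arep_image_cofinite.
      move=> _ [[p S'p <-] _]; have [dc _ _] := arep_bij g; exact/dc/S'g.
    by apply: cofinite_subspaceI => //; apply: arep_image_cofinite.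
  apply/seteqP; split=> [p [S'p Sp]|_ [_ [[p S'p <-] Sp] <-]].
    exists (arep_fun g p); first by split=> //; exists p.
    exact/fun_invK/S'g.
  by rewrite /= fun_invK//; apply: S'g.
- by move=> p [S'p Sp]; split; [apply: S'g|apply: Sf].
move=> p [S'p Sp]; have [tg [k sk ek]] := hg _ S'p; have [tf [m sm em]] := hf _ Sp.
split; first by rewrite /= tf.
exists (k * m); first exact: is_signM.
by rewrite -lmulA ek lmulzr em -mulrzA mulrC.
Qed.

(** The domain consists of all paths that [x] sends to signed paths, and the codomain is the same
    set for [x^*], because [x^*] undoes what [x] sends. Right multiplication by paths gives the
    Higman-Thompson property. *)
Lemma unitary_represents x : is_unitary R x ->
  exists f, HT_rep f /\ represents x f.
Proof.
move=> ux; pose D y : set (walk R) := [set p | exists q, sends y p q].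
have cD y : is_unitary R y -> cofinite_subspace (D y).
  move=> /unitary_sends[n hn]; have [fd _ ld] := @deep_cofinite G R n; split.
  - by apply: sub_finite_set fd => p nDp /hn.
  - by move=> p _ [q pq] [r ->]; have [q' _ ?] := sends_wcat r pq; exists q'.
  - by move=> p /ld /hn.
have /choice[f hf] : forall p, exists q, D x p -> sends x p q.
  move=> p; have [[q pq]|nDp] := pselect (D x p); first by exists q.
  by exists p.
have uVx := is_unitaryV ux.
have sx p q : sends (lstar x) p q -> sends x q p.
  by move=> /(sends_star uVx); rewrite lstarK.
have bf : set_bij (D x) (D (lstar x)) f.
  split.
  - by move=> p /hf /(sends_star ux) h; exists p.
  - move=> p p'; rewrite !inE => /hf /(sends_star ux) h /hf /(sends_star ux) h' e.
    by rewrite e in h; apply: sends_inj h h'.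
  - move=> q [p /sx pq]; exists p; first by exists q.
    by apply: (sends_inj _ pq); apply: hf; exists q.
have wf p q : D x p -> D x q -> wle p q <-> wle (f p) (f q).
  move=> /hf hp /hf hq; split; first exact: sends_wle hp hq.
  exact: sends_wle (sends_star ux hp) (sends_star ux hq).
exists (AlmostAutRep (cD _ ux) (cD _ uVx) bf wf); split.
  apply/HT_repP => p /= /hf hp; split=> [|r]; first by case: hp.
  have [q' <- hq'] := sends_wcat r hp.
  by rewrite (@sends_inj _ _ _ _ _ _ (hf _ _) hq')//; exists q'.
by exists (D x); split=> //; apply: cD.
Qed.

(** As [h b] is incomparable with every other [h b'], all products [(h b')^* h b] with [b' != b]
    vanish. *)
Lemma matrix_units_mul (l : seq (walk R)) (g : walk R -> leavitt G)
    (h : walk R -> walk R) b : uniq l -> b \in l ->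
  {in l, forall b', wle (h b') (h b) \/ wle (h b) (h b') -> b' = b} ->
  (\sum_(b' <- l) g b' ** lstar (lpath (h b'))) ** lpath (h b) =
  g b ** lvertex (tgt (h b)).
Proof.
move=> ul bl ind; rewrite lmul_suml (bigD1_seq b)//= -lmulA lpath_star_path.
rewrite big_seq_cond big1 ?addr0// => b' /andP[b'l /eqP neq]; rewrite -lmulA.
have [h1|h1|->] := wle_trichotomy (h b') (h b); last by rewrite lmul0.
  by case: neq; apply: ind => //; left.
by case: neq; apply: ind => //; right.
Qed.

(** The witness is the sum of [f(b) b^*] over a basis; it sends [p] to [f(p)] with sign [1] on the
    whole domain, and its adjoint reverses this. *)
Lemma HT_rep_represents f : HT_rep f ->
  exists2 x, is_unitary R x & represents x f.
Proof.
move=> /HT_repP hf.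
have cf := arep_dom_cofinite f; have [B [fB iB Bd dB]] := cofinite_subspace_basis cf.
pose l : seq (walk R) := enum_fset (fset_set B).
have lB b : b \in l = (b \in B) by rewrite in_fset_set.
have ul : uniq l := fset_uniq _.
pose F := arep_fun f.
have tF b : b \in l -> tgt (F b) = tgt b.
  by rewrite lB inE => /Bd /hf[].
have iF b b' : b \in l -> b' \in l -> wle (F b) (F b') -> b = b'.
  rewrite !lB !inE => Bb Bb' /(arep_wle (Bd _ Bb) (Bd _ Bb')); exact: iB.
have il b b' : b \in l -> b' \in l -> wle b b' -> b = b'.
  by rewrite !lB !inE; apply: iB.
pose x := \sum_(b <- l) lpath (F b) ** lstar (lpath b).
have xV : lstar x = \sum_(b <- l) lpath b ** lstar (lpath (F b)).
  by rewrite /x lstar_sum; apply: eq_bigr => b _; rewrite lstarM lstarK.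
have rx : rooted_leavitt R x.
  rewrite /x big_seq; apply: big_ind => [||b /tF tb]; [exact: rooted0|exact: rootedD|].
  exact: rooted_gen.
have hx b (r : walk (tgt b)) : b \in l -> x ** lpath (wcat r) = lpath (F (wcat r)).
  move=> bl; have := bl; rewrite lB inE => Bb; have [_ hb] := hf _ (Bd _ Bb).
  rewrite lpathM lmulA (@matrix_units_mul l _ id)//; last first.
    by move=> b' b'l [/il->|/il->].
  rewrite -lmulA lvertex_path; apply/esym/lpath_cat; [exact: tF|exact: hb].
have hVx b (r : walk (tgt b)) : b \in l -> lstar x ** lpath (F (wcat r)) = lpath (wcat r).
  move=> bl; have := bl; rewrite lB inE => Bb; have [_ hb] := hf _ (Bd _ Bb).
  rewrite (@lpath_cat _ _ _ b (F b) (F (wcat r)) r)//; last exact: tF.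
  rewrite lmulA xV (@matrix_units_mul l _ F)//; last first.
    by move=> b' b'l [/iF->|/iF->].
  by rewrite tF// lpath_ter lpathM.
have Dx p : arep_dom f p -> x ** lpath p = lpath (F p).
  by move=> /dB[b Bb [r ->]]; apply: hx; rewrite lB inE.
have DVx p : arep_dom f p -> lstar x ** lpath (F p) = lpath p.
  by move=> /dB[b Bb [r ->]]; apply: hVx; rewrite lB inE.
have rVx := rooted_star rx.
have [n hn] := cofinite_deep cf; have [m hm] := cofinite_deep (arep_cod_cofinite f).
exists x; last first.
  exists (arep_dom f); split=> // p fp; split; first by case: (hf p fp).
  by exists 1; [left|rewrite mulr1z Dx].
have R1 := lvertexI R.
split=> //.
(* Unitarity is tested on deep paths only: those in the codomain for [x x^*], those in the domain
   for [x^* x]. *)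
- apply: (@deep_ext G R m) => //; first exact/rooted_mul1/rootedM.
  move=> q /hm fq; have [_ _ /(_ q fq)[p fp <-]] := arep_bij f.
  by rewrite -lmulA DVx// Dx// lvertex_path.
- apply: (@deep_ext G R n) => //; first exact/rooted_mul1/rootedM.
  by move=> p /hn fp; rewrite -lmulA Dx// DVx// lvertex_path.
Qed.

Lemma deep_above n p : exists2 q, wle p q & deep n q.
Proof.
have [s [ws hs]] := deep_walk (tgt p) n; exists (wcat (Walk ws)).
  by exists (Walk ws).
case: hs => hs; [left|right]; first by rewrite size_cat (leq_trans hs) ?leq_addl.
by apply/leafP; rewrite /tgt /= word_end_cat.
Qed.

Lemma wle_comparable p q r : wle p r -> wle q r -> wle p q \/ wle q p.
Proof.
wlog le : p q / (size (edges p) <= size (edges q))%N => [H pr qr|].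
  by have /orP[/H|/H] := leq_total (size (edges p)) (size (edges q));
    [apply|move=> /(_ qr pr)[]; [right|left]].
move=> /wleP[s pE] /wleP[t qE]; left; apply/wleP.
exists (drop (size (edges p)) (edges q)); rewrite -[LHS](cat_take_drop (size (edges p))).
congr (_ ++ _); rewrite -[in LHS](take_size_cat t (erefl (size (edges q)))).
by rewrite -qE take_takel// pE take_size_cat.
Qed.

(** Any path [c] has a deep extension in [S], which also has a prefix [b] in [B]. Thus [b] and [c]
    are comparable, and independence of [C] identifies them. *)
Lemma basis_maximal (S B : set (walk R)) : cofinite_subspace S -> is_basis S B ->
  finite_maximal_basis B.
Proof.
move=> cS [fB iB BS SB]; split=> // C iC BC; apply/seteqP; split=> // c Cc.
have [n hn] := cofinite_deep cS; have [q cq /hn /SB[b Bb bq]] := deep_above n c.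
by have [/(iC _ _ Cc (BC _ Bb))->|/(iC _ _ (BC _ Bb) Cc)<-] := wle_comparable cq bq.
Qed.

(** By maximality every path is comparable with some element of [B]; one that lies above none is a
    proper prefix of an element of [B], hence of bounded length. *)
Lemma maximal_basis_cofinite (B : set (walk R)) : finite_maximal_basis B ->
  cofinite_subspace [set p | exists2 b, B b & wle b p].
Proof.
move=> [/finite_fsetP[F BF] iB mB].
have cmp p : exists2 b, B b & wle b p \/ wle p b.
  apply: contrapT => npB.
  have nB b : B b -> ~ wle b p /\ ~ wle p b.
    by move=> Bb; split=> h; apply: npB; exists b => //; [left|right].
  have BpB : p |` B = B.
    apply: mB; last by move=> b Bb; right.
    move=> b b' [->|Bb] [->|Bb']//; last exact: iB.
    - by move=> /(proj2 (nB _ Bb')).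
    - by move=> /(proj1 (nB _ Bb)).
  have Bp : B p by rewrite -BpB; left.
  by apply: (nB p Bp).1; apply: wle_refl.
split.
- apply: sub_finite_set (finite_short R (\max_(b <- enum_fset F) size (edges b))) => p /= np.
  have [b Bb [bp|pb]] := cmp p; first by case: np; exists b.
  have [bE|/(wle_size pb) lt] := eqVneq b p.
    by case: np; exists b => //; rewrite bE; apply: wle_refl.
  have bF : b \in F by move: Bb; rewrite BF.
  apply: (leq_trans lt).
  exact: (@leq_bigmax_seq _ (enum_fset F) xpredT (fun p => size (edges p)) b bF isT).
- by move=> p q [b Bb bp] pq; exists b => //; apply: wle_trans pq.
- move=> p lp; have [b Bb [bp|pb]] := cmp p; first by exists b.
  by exists b => //; rewrite (lp _ pb); apply: wle_refl.
Qed.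

(** If [u p = p] up to sign on a cofinite subspace, the signs at its basis determine [u], since
    [u (b r) = (u b) r]. Conversely, a diagonal element scales every path above [b] by its
    coefficient at [b]. *)
Lemma represents_id (u : unitary R) :
  represents (val u) (arep_id R) <-> u \in diagonal_unitary R.
Proof.
split.
- move=> [S [cS _ h]]; have [B bB] := cofinite_subspace_basis cS.
  have [fB iB BS SB] := bB.
  (* Outside [S] the sign defaults to [1]. *)
  have /choice[k hk] : forall p, exists k : int,
      is_sign k /\ (S p -> val u ** lpath p = lpath p *~ k).
    move=> p; have [/h[_ [k sk e]]|nS] := pselect (S p); first by exists k.
    by exists 1; split; first by left.
  apply/asboolP; exists (fset_set B), k; split.
  + by rewrite fset_setK//; apply: basis_maximal bB.
  + by move=> b _; apply: (hk b).1.
  have lB b : b \in enum_fset (fset_set B) = (b \in B) by rewrite in_fset_set.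
  have [n hn] := cofinite_deep cS.
  apply: (@deep_ext G R n).
  + by case: (unitaryP u) => ru _ _; apply: rooted_mul1.
  + apply: rooted_mul1; apply: big_ind => [||b _]; [exact: rooted0|exact: rootedD|].
    by apply/rootedZ/rooted_gen.
  move=> p /hn /SB[b Bb [r ->]]; rewrite lpathM !lmulA (hk b).2; last exact: BS.
  (* Moving the sign onto the left factor gives the shape of [matrix_units_mul]. *)
  under eq_bigr do rewrite -lmulzl.
  rewrite (@matrix_units_mul _ (fun b => lpath b *~ k b) id)//.
  + by rewrite !lmulzl /= lpath_ter.
  + exact: fset_uniq.
  + by rewrite lB inE.
  move=> b'; rewrite lB inE => Bb' [/iB->|/iB->]//.
- move=> /asboolP[B [k [mB kB uE]]].
  exists [set p | exists2 b, [set` B] b & wle b p]; split=> //.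
    exact: maximal_basis_cofinite.
  move=> p [b Bb [r ->]]; split=> //; exists (k b); first exact: kB.
  have [_ iB _] := mB.
  rewrite uE lpathM lmulA; under eq_bigr do rewrite -lmulzl.
  rewrite (@matrix_units_mul _ (fun b => lpath b *~ k b) id)//.
  + by rewrite !lmulzl lpath_ter.
  + exact: fset_uniq.
  move=> b' Bb' [/iB->|/iB->]//.
Qed.

End Represents.

(** * The germ homomorphism, its kernel and the isomorphism *)

Section UnitaryGerm.
Variables (G : graph) (R : vertex G).

(** The equivalence, rather than mere existence of a representative, lets products and the kernel be
    computed with any representative. *)
Lemma exists_germ (u : unitary R) : exists h : HT R,
  forall f, aclass f = val h <-> represents (val u) f.
Proof.
have [f [hf uf]] := unitary_represents (unitaryP u).
have inHT : aclass f \in @in_HT G R by apply/asboolP; exists f.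
exists (exist _ (aclass f) inHT) => g; split=> [/= /aclassP gf|ug].
  exact/(represents_equiv _ uf)/arep_equiv_sym.
exact/aclassP/(represents_inj ug uf).
Qed.

Definition germ (u : unitary R) : HT R := sval (cid (exists_germ u)).

Lemma germP u f : aclass f = val (germ u) <-> represents (val u) f.
Proof. exact: (svalP (cid (exists_germ u))). Qed.

Lemma germM u v : germ (u * v)%g = (germ u * germ v)%g.
Proof.
apply: val_inj; apply/esym.
rewrite [LHS](_ : _ = aclass (arep_comp (repr (val (germ u))) (repr (val (germ v)))))//.
by apply/germP/represents_comp; apply/germP; rewrite aclassK.
Qed.

Lemma germ1 : germ 1%g = 1%g.
Proof. by apply: (@mulgI _ (germ 1%g)); rewrite -germM !mulg1. Qed.

Lemma germV u : germ u^-1%g = (germ u)^-1%g.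
Proof. by apply: (@mulgI _ (germ u)); rewrite -germM !mulgV germ1. Qed.

Lemma germ_eq1 u : germ u = 1%g <-> u \in diagonal_unitary R.
Proof.
rewrite -represents_id -germP; split=> [->//|e].
by apply: val_inj; rewrite -e.
Qed.

Lemma germ_surj h : exists u, germ u = h.
Proof.
have /asboolP[f /HT_rep_represents[x ux xf] fh] := valP h.
exists (mk_unitary ux); apply: val_inj; rewrite -[RHS]fh.
by apply/esym/germP.
Qed.

(** Being the kernel of [germ], it needs no computation with common refinements of bases. *)
Lemma diagonal_unitary_normal : normal_subgroup (diagonal_unitary R).
Proof.
split; first split.
- exact/germ_eq1/germ1.
- move=> u v /germ_eq1 u1 /germ_eq1 v1; apply/germ_eq1.
  by rewrite germM germV u1 v1 mulgV.
- move=> u v /germ_eq1 u1; apply/germ_eq1.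
  by rewrite /conjg !germM germV u1 mul1g mulVg.
Qed.

Lemma coset_class_germ (nDU : normal_subgroup (diagonal_unitary R)) u v :
  coset_class nDU u = coset_class nDU v <-> germ u = germ v.
Proof.
rewrite coset_classP -germ_eq1 germM germV; split=> [e|->]; last exact: mulVg.
by apply: (@mulgI _ (germ u)^-1%g); rewrite mulVg e.
Qed.

End UnitaryGerm.

Theorem lemma9 (G : graph) (R : vertex G) (rootR : is_root R) :
  exists (nDU : normal_subgroup (diagonal_unitary R))
         (f : {multiplicative HT R -> quotient_group nDU}), bijective f.
Proof.
exists (diagonal_unitary_normal R); set nDU := diagonal_unitary_normal R.
(* A set-theoretic section of [germ]; its class modulo the kernel does not depend on the choice,
   hence is multiplicative. *)
have [lift liftK] := choice (@germ_surj G R).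
pose f h : quotient_group nDU := coset_class nDU (lift h).
have fM : {morph f : h h' / (h * h')%g}.
  move=> h h'; rewrite [RHS]coset_classM; apply/coset_class_germ.
  by rewrite germM !liftK.
pose F : {multiplicative HT R -> quotient_group nDU} :=
  HB.pack f (isMultiplicative.Build _ _ f fM).
exists F.
exists (fun x => germ (repr x)) => [h|x] /=.
  by rewrite -[RHS]liftK; apply/(coset_class_germ nDU); rewrite coset_classK.
by rewrite -[RHS]coset_classK; apply/coset_class_germ; rewrite liftK.
Qed.
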